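(* Let $\mu=\mu_1\otimes\dots\otimes\mu_d$ be a product probability measure on $\mathbb{R}^d$ whose marginals admit a second moment. Let $f,g:\mathbb{R}^d\to\mathbb{R}$ be functions in $L^2(\mu)$ all of whose first and second partial derivatives are integrable with respect to $\mu$. (1) Let $f=e^{-\phi}$ and suppose that for all $1\le i,j\le d$ and all $x\in\mathbb{R}^d$, $$\partial_{i,j}\phi(x)\le 0\quad\text{and}\quad\partial_{i,j}g(x)\ge 0.$$ Assume moreover that $f$ is orthogonal to the coordinate functions, i.e. $\mathrm{Cov}_\mu(f(x),x_i)=0$ for all $1\le i\le d$. Then $\mathrm{Cov}_\mu(f,g)\ge 0$. (2) Let $f=e^{-\phi}$ and $g=e^{-\psi}$ and suppose that for all $1\le i,j\le d$ and all $x\in\mathbb{R}^d$, $$\partial_{i,j}\phi(x)\le 0\quad\text{and}\quad\partial_{i,j}\psi(x)\le 0.$$ Assume moreover that the product measure $\mu$ is symmetric and that both $f$ and $g$ are even. Then $\mathrm{Cov}_\mu(f,g)\ge 0$.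
   Context: $\mathrm{Cov}_\mu(f,g)=\int (f-\int f\,d\mu)(g-\int g\,d\mu)\,d\mu$. A measure $\mu$ on $\mathbb{R}^d$ is symmetric if it is invariant under $x\mapsto -x$; a function $f$ on $\mathbb{R}^d$ is even if $f(-x)=f(x)$. Standing convention: all functions have enough integrability and regularity for all written quantities to be well defined. *)

(* Defs.v *)
From HB Require Import structures.
From mathcomp Require Import all_boot all_order all_algebra.
From mathcomp Require Import all_classical all_reals all_analysis.

Set Implicit Arguments.
Unset Strict Implicit.
Unset Printing Implicit Defensive.

Import Order.TTheory GRing.Theory Num.Theory.
Import numFieldNormedType.Exports.

Local Open Scope classical_set_scope.
Local Open Scope ring_scope.

(* R^n is 'rV[R]_n, which carries the library's topology and derivatives but
   no sigma-algebra. We give it the product sigma-algebra generated by the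
   coordinates, as the library does for n.-tuple T; for T = R it is the Borel
   sigma-algebra. *)
Section measurable_rowvector.
Context {d : measure_display} {T : measurableType d}.
Variable n : nat.

Let coors : 'I_n -> 'rV[T]_n -> T := fun i x => x ord0 i.

Let rV_set0 : g_sigma_preimage coors set0.
Proof. exact: sigma_algebra0. Qed.

Let rV_setC A : g_sigma_preimage coors A -> g_sigma_preimage coors (~` A).
Proof. exact: sigma_algebraC. Qed.

Let rV_bigcup (F : _^nat) : (forall i, g_sigma_preimage coors (F i)) ->
  g_sigma_preimage coors (\bigcup_i (F i)).
Proof. exact: sigma_algebra_bigcup. Qed.

HB.instance Definition _ := @isMeasurable.Build (measure_tuple_display d)
  'rV[T]_n (g_sigma_preimage coors) rV_set0 rV_setC rV_bigcup.

End measurable_rowvector.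

Section definitions.
Context {R : realType} {d : nat}.
Implicit Types (f : 'rV[R]_d -> R) (mu : probability 'rV[R]_d R).

(* mu is the product of the mus i: these values on measurable boxes determine
   a unique probability measure on the product sigma-algebra. *)
Definition is_product_probability (mus : 'I_d -> probability R R) mu : Prop :=
  forall A : 'I_d -> set R, (forall i, measurable (A i)) ->
    mu [set x | forall i, A i (x ord0 i)] = (\prod_(i < d) mus i (A i))%E.

Definition symmetric_measure mu : Prop :=
  forall A : set 'rV[R]_d, measurable A -> mu [set x | A (- x)] = mu A.

Definition even_fun f : Prop := forall x, f (- x) = f x.

Definition partial (i : 'I_d) f : 'rV[R]_d -> R := 'D_(delta_mx ord0 i) f.

(* partial2 i j f is $\partial_{i,j} f = \partial_i (\partial_j f)$ *)
Definition partial2 (i j : 'I_d) f : 'rV[R]_d -> R := partial i (partial j f).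

(* 'D_v f x is a default value when the limit does not exist, hence this
   explicit existence condition. *)
Definition twice_partially_derivable f : Prop :=
  (forall i x, derivable f x (delta_mx ord0 i)) /\
  (forall i j x, derivable (partial j f) x (delta_mx ord0 i)).

Definition integrable_partials mu f : Prop :=
  (forall i, mu.-integrable setT (EFin \o partial i f)) /\
  (forall i j, mu.-integrable setT (EFin \o partial2 i j f)).

End definitions.

(* Main.v *)
Require Import Defs.
From HB Require Import structures.
From mathcomp Require Import all_boot all_order all_algebra.
From mathcomp Require Import all_classical all_reals all_analysis.
From mathcomp Require Import measurable_realfun ring lra.
Import Order.TTheory GRing.Theory Num.Theory.
Import numFieldNormedType.Exports.
Local Open Scope classical_set_scope.
Local Open Scope ring_scope.

Set Implicit Arguments.
Unset Strict Implicit.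
Unset Printing Implicit Defensive.

(** Let x and w be independent with law mu, and let T_n be the mean of f (x) g
(w_1, .., w_n, x_(n+1), .., x_d). Then T_0 is the mean of f g and T_d is the
product of the means, so it is enough that T_n never increases with n.

Both f and g are convex along each coordinate: for g in the first part this is
the hypothesis on its second derivatives, and otherwise the function is the
exponential of a function convex along each coordinate. For functions of one
variable, convexity implies that the covariance is at least that of the linear
regressions on the variable (covariance_regression, an instance of Andreief's
identity). Applied to the coordinate k that is replaced between two consecutive
values T and T' of the sequence, and integrated over the other coordinates, this
gives Var (x_k) (T - T') >= J (cross_le; if the variance is 0 then T = T'),
where J is the mean of f (x) X (x) X (w) g (w_1, .., w_k, x_(k+1), .., x_d) and
X is the centered k-th coordinate. It remains to see that J >= 0.

The exponential of a function with nonnegative mixed derivatives is log-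
supermodular, so f can serve as the weight of an FKG inequality. In the first
part (cross_ge0_orthogonal), the increments of g along k are increasing in the
other coordinates. As X is orthogonal to f, the FKG inequality shows that
integrating f X g over x leaves a nondecreasing function of w_k, whose
correlation with X (w) is nonnegative. In the second part (cross_ge0_even), f
(x) g (w_1, .., w_k, x_(k+1), .., x_d) is a log-supermodular weight on pairs (x,
w), for which x_k and w_k are positively correlated, and they have mean zero
because this weight is even.

The FKG inequality comes from the four functions theorem, proved by averaging
out the coordinates one by one. All these arguments use the product structure of
mu through the exchange of some coordinates of x with those of w, which
preserves the joint law (preserving_swap). Exchanging rather than splitting off
coordinates keeps every function on the full space, where the pointwise
convexity and supermodularity of f and g are available; integrability of their
sections holds almost everywhere only. *)

(** * Integrable and square-integrable functions *)

Definition L1 {disp} {T : measurableType disp} {R : realType}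
    (P : probability T R) (h : T -> R) : Prop :=
  P.-integrable setT (EFin \o h).

Definition L2 {disp} {T : measurableType disp} {R : realType}
    (P : probability T R) (h : T -> R) : Prop :=
  measurable_fun setT h /\ L1 P (fun x => h x ^+ 2).

Section expectation.
Context {disp : measure_display} {T : measurableType disp} {R : realType}.
Variable P : probability T R.
Implicit Types (a b h : T -> R) (c : R).

Lemma L1_measurable h : L1 P h -> measurable_fun setT h.
Proof. by move=> /integrableP[/measurable_EFinP]. Qed.

Lemma eq_L1 a b : a =1 b -> L1 P a -> L1 P b.
Proof. by move=> /funext ->. Qed.

Lemma eq_L2 a b : a =1 b -> L2 P a -> L2 P b.
Proof. by move=> /funext ->. Qed.

Lemma L1D a b : L1 P a -> L1 P b -> L1 P (fun x => a x + b x).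
Proof. by move=> ia ib; exact: (integrableD measurableT ia ib). Qed.

Lemma L1B a b : L1 P a -> L1 P b -> L1 P (fun x => a x - b x).
Proof. by move=> ia ib; exact: (integrableB measurableT ia ib). Qed.

Lemma L1Z c a : L1 P a -> L1 P (fun x => c * a x).
Proof. by move=> ia; exact: (integrableZl measurableT c ia). Qed.

Lemma L1_cst c : L1 P (fun=> c).
Proof. exact: finite_measure_integrable_cst. Qed.

Lemma L1_le a b : measurable_fun setT a -> (forall x, `|a x| <= b x) ->
  L1 P b -> L1 P a.
Proof.
move=> ma ab ib; apply: (le_integrable measurableT _ _ ib).
  exact/measurable_EFinP.
by move=> x _ /=; rewrite lee_fin (le_trans (ab x))// ler_norm.
Qed.

Lemma L2_mul a b : L2 P a -> L2 P b -> L1 P (fun x => a x * b x).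
Proof.
move=> [ma ia] [mb ib].
apply: (@L1_le _ (fun x => 2^-1 * (a x ^+ 2 + b x ^+ 2))).
- exact: measurable_funM.
- move=> x; rewrite ler_norml.
  have := sqr_ge0 (a x - b x); have := sqr_ge0 (a x + b x).
  by rewrite sqrrB sqrrD; lra.
- by apply: L1Z; apply: L1D.
Qed.

Lemma L2_cst c : L2 P (fun=> c).
Proof. by split; [exact: measurable_cst|exact: L1_cst]. Qed.

Lemma L2_L1 a : L2 P a -> L1 P a.
Proof.
move=> /L2_mul/(_ (L2_cst 1)).
by under eq_fun do rewrite mulr1.
Qed.

Lemma L2D a b : L2 P a -> L2 P b -> L2 P (fun x => a x + b x).
Proof.
move=> ha hb; have iab := L2_mul ha hb.
case: ha hb => [ma ia] [mb ib]; split; first exact: measurable_funD.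
under eq_fun do rewrite sqrrD.
by apply: L1D => //; apply: L1D => //; apply: L1D.
Qed.

(** The real-valued integral of a measurable function that is not integrable
is 0, and multiplying by a nonzero constant does not change integrability. This
allows pulling constants out of sections that are integrable only almost
everywhere. *)
Lemma RintZ c h : measurable_fun setT h ->
  \int[P]_x (c * h x) = c * \int[P]_x h x.
Proof.
move=> mh; have [->|c0] := eqVneq c 0.
  rewrite mul0r /Rintegral; under eq_integral do rewrite mul0r.
  by rewrite integral0.
have [ih|nih] := pselect (L1 P h); first exact: RintegralZl.
have nint a : measurable_fun setT a -> ~ L1 P a -> \int[P]_x a x = 0.
  move=> ma nia; have mEa : measurable_fun setT (EFin \o a).
    exact/measurable_EFinP.
  apply/eqP/negP => /negP fa0; apply: nia; apply/integrableP; split => //.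
  rewrite (integral_fin_num_abs P measurableT ma).
  by apply: contraNT fa0; rewrite /Rintegral; case: (integral P _ _).
rewrite !nint// ?mulr0//; first exact: measurable_funM.
move=> /(L1Z c^-1) ich; apply: nih.
by move: ich; under eq_fun do rewrite mulKf//.
Qed.

Lemma RintD a b : L1 P a -> L1 P b ->
  \int[P]_x (a x + b x) = \int[P]_x a x + \int[P]_x b x.
Proof. by move=> ia ib; exact: RintegralD. Qed.

Lemma RintB a b : L1 P a -> L1 P b ->
  \int[P]_x (a x - b x) = \int[P]_x a x - \int[P]_x b x.
Proof. by move=> ia ib; exact: RintegralB. Qed.

Lemma Rint_cst c : \int[P]_x c = c.
Proof. by rewrite Rintegral_cst//= probability_setT mulr1. Qed.

Lemma L1_fineK a : L1 P a -> ((\int[P]_x a x)%:E = \int[P]_x (a x)%:E)%E.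
Proof. by move=> ia; rewrite /Rintegral fineK//; exact: integrable_fin_num. Qed.

Lemma ae_le_Rint a b : L1 P a -> L1 P b -> {ae P, forall x, a x <= b x} ->
  \int[P]_x a x <= \int[P]_x b x.
Proof.
move=> ia ib ab; rewrite -subr_ge0 -RintB//.
rewrite /Rintegral (@ae_eq_integral _ _ _ P setT (fun x => `|b x - a x|%:E))//.
- by apply: fine_ge0; apply: integral_ge0.
- by apply/measurable_EFinP/L1_measurable/L1B.
- by apply/measurable_EFinP/measurableT_comp => //; exact/L1_measurable/L1B.
- by apply: filterS ab => x ab _; rewrite ger0_norm// subr_ge0.
Qed.

Lemma ae_eq_Rint a b : L1 P a -> L1 P b -> {ae P, forall x, a x = b x} ->
  \int[P]_x a x = \int[P]_x b x.
Proof.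
move=> ia ib ab; apply/eqP; rewrite eq_le !ae_le_Rint//;
  by apply: filterS ab => x ->.
Qed.

Lemma Rint_gt0 a : L1 P a -> (forall x, 0 < a x) -> 0 < \int[P]_x a x.
Proof.
move=> ia a0; rewrite lt_def Rintegral_ge0 ?andbT; last by move=> x _; exact: ltW.
apply/eqP => ia0.
have : (\int[P]_x `|(a x)%:E| = 0)%E.
  under eq_integral do rewrite gee0_abs ?lee_fin ?ltW//.
  by rewrite -L1_fineK// ia0.
move/(ae_eq_integral_abs P measurableT (measurable_int _ ia)).
move=> [N [mN N0]] sub.
have : (P setT <= P N)%E.
  apply: le_measure; rewrite ?inE// => x _; apply: sub => /(_ I)/= [] ax0.
  by move: (a0 x); rewrite ax0 ltxx.
by rewrite N0 probability_setT lee_fin ler10.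
Qed.

End expectation.

(** * Measure-preserving maps and product measures *)

Section preserving.
Context {d1 d2 : measure_display} {T1 : measurableType d1}
  {T2 : measurableType d2} {R : realType}.
Variables (P1 : probability T1 R) (P2 : probability T2 R).

Definition preserving (tau : T1 -> T2) : Prop :=
  measurable_fun setT tau /\
  forall A, measurable A -> P1 (tau @^-1` A) = P2 A.

Lemma preserving_ge0_integral tau (h : T2 -> \bar R) : preserving tau ->
  measurable_fun setT h -> (forall x, 0 <= h x)%E ->
  (\int[P2]_y h y = \int[P1]_x h (tau x))%E.
Proof.
move=> [mtau Ptau] mh h0.
transitivity (\int[pushforward P1 tau]_y h y)%E.
  by apply: eq_measure_integral => A mA _; first [exact: Ptau|exact/esym/Ptau].
by rewrite (ge0_integral_pushforward mtau).
Qed.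

Lemma preserving_L1 tau h : preserving tau -> L1 P2 h -> L1 P1 (h \o tau).
Proof.
move=> ptau ih; have mh := L1_measurable ih.
apply/integrableP; split.
  by apply/measurable_EFinP; apply: measurableT_comp => //; case: ptau.
rewrite -(preserving_ge0_integral (h := fun x => `|(h x)%:E|%E) ptau)//.
- by case/integrableP : ih.
- by apply: measurableT_comp => //; exact/measurable_EFinP.
Qed.

Lemma preserving_L2 tau h : preserving tau -> L2 P2 h -> L2 P1 (h \o tau).
Proof.
move=> ptau [mh ih]; split; last exact: (preserving_L1 ptau ih).
by apply: measurableT_comp => //; case: ptau.
Qed.

Lemma preserving_Rint tau h : preserving tau -> L1 P2 h ->
  \int[P2]_y h y = \int[P1]_x h (tau x).
Proof.
move=> ptau ih; have [mtau Ptau] := ptau.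
congr fine; transitivity (\int[pushforward P1 tau]_y (h y)%:E)%E.
  by apply: eq_measure_integral => A mA _; first [exact: Ptau|exact/esym/Ptau].
rewrite (integral_pushforward mtau)//; first exact: measurable_int ih.
exact: (preserving_L1 ptau ih).
Qed.

End preserving.

Section preserving_comp.
Context {d1 d2 d3 : measure_display} {T1 : measurableType d1}
  {T2 : measurableType d2} {T3 : measurableType d3} {R : realType}.
Variables (P1 : probability T1 R) (P2 : probability T2 R)
  (P3 : probability T3 R).

Lemma preserving_comp (s : T2 -> T3) (t : T1 -> T2) :
  preserving P2 P3 s -> preserving P1 P2 t -> preserving P1 P3 (s \o t).
Proof.
move=> [ms Ps] [mt Pt]; split; first exact: measurableT_comp.
move=> A mA; rewrite comp_preimage Pt ?Ps//.
by rewrite -[X in measurable X]setTI; exact: ms.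
Qed.

End preserving_comp.

Section product.
Context {d1 d2 : measure_display} {T1 : measurableType d1}
  {T2 : measurableType d2} {R : realType}.
Variables (P1 : probability T1 R) (P2 : probability T2 R).
Local Notation P12 := ((P1 \x P2)%E : probability (T1 * T2)%type R).

Lemma preserving_fst : preserving P12 P1 fst.
Proof.
split; first exact: measurable_fst.
move=> A mA; rewrite -[RHS]mule1 -(@probability_setT _ _ _ P2).
rewrite -product_measure1E//; congr (_ _).
by apply/seteqP; split => -[x y]//= [].
Qed.

Lemma preserving_snd : preserving P12 P2 snd.
Proof.
split; first exact: measurable_snd.
move=> A mA; rewrite -[RHS]mul1e -(@probability_setT _ _ _ P1).
rewrite -product_measure1E//; congr (_ _).
by apply/seteqP; split => -[x y]//= [].
Qed.

Lemma L1_prod a b : L1 P1 a -> L1 P2 b -> L1 P12 (fun z => a z.1 * b z.2).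
Proof.
move=> ia ib; have ma := L1_measurable ia; have mb := L1_measurable ib.
have mab : measurable_fun setT (fun z : T1 * T2 => a z.1 * b z.2).
  by apply: measurable_funM; apply: measurableT_comp.
apply/integrable12ltyP; first exact/measurable_EFinP.
under eq_integral => x _.
  under eq_integral => y _ do rewrite /= normrM EFinM.
  rewrite ge0_integralZl//; last first.
    by apply/measurable_EFinP; apply: measurableT_comp.
  rewrite -[X in (_ * X)%E]fineK; last first.
    rewrite ge0_fin_numE ?integral_ge0//.
    by case/integrableP : ib.
  over.
rewrite ge0_integralZr//; last 2 first.
- by apply/measurable_EFinP; apply: measurableT_comp.
- by rewrite lee_fin fine_ge0// integral_ge0.
apply: lte_mul_pinfty => //.
- exact: integral_ge0.
- rewrite ge0_fin_numE ?integral_ge0//.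
  by case/integrableP : ia.
- exact: ltry.
Qed.

Lemma L2_prod a b : L2 P1 a -> L2 P2 b -> L2 P12 (fun z => a z.1 * b z.2).
Proof.
move=> [ma ia] [mb ib]; split.
  by apply: measurable_funM; apply: measurableT_comp.
by under eq_fun do rewrite exprMn; exact: (L1_prod ia ib).
Qed.

Variable h : T1 -> T2 -> R.
Hypothesis ih : L1 P12 (fun z => h z.1 z.2).

Lemma ae_L1_section : {ae P1, forall x, L1 P2 (h x)}.
Proof. exact: (ae_integrable1 ih). Qed.

Lemma ae_L1_section2 : {ae P2, forall y, L1 P1 (h ^~ y)}.
Proof. exact: (ae_integrable2 ih). Qed.

Lemma L1_Rint : L1 P1 (fun x => \int[P2]_y h x y).
Proof.
have iF := integrable_fubini_F ih.
apply: (le_integrable measurableT _ _ iF).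
- apply/measurable_EFinP; rewrite /Rintegral.
  apply: (measurableT_comp (fine_measurable measurableT)).
  exact: measurable_int iF.
- move=> x _ /=; rewrite /Rintegral /fubini_F/=.
  by case: (integral P2 _ _) => //= *; rewrite leey.
Qed.

Lemma Rint_prod : \int[P12]_z h z.1 z.2 = \int[P1]_x \int[P2]_y h x y.
Proof.
rewrite [in LHS]/Rintegral -(integral12_prod_meas1 ih) /Rintegral; congr fine.
have iF := integrable_fubini_F ih.
apply: ae_eq_integral => //.
- exact: measurable_int iF.
- exact/measurable_EFinP/L1_measurable/L1_Rint.
- by apply: filterS ae_L1_section => x ix _; rewrite /= -/(Rintegral _ _ _) L1_fineK.
Qed.

End product.


Section product_preserving.
Context {d1 d2 d3 : measure_display} {T1 : measurableType d1}
  {T2 : measurableType d2} {T3 : measurableType d3} {R : realType}.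
Variables (P1 : probability T1 R) (P2 : probability T2 R) (P3 : probability T3 R).

(** A measure on a product space is determined by its values on rectangles. *)
Lemma preserving_to_prod (tau : T3 -> T1 * T2) : measurable_fun setT tau ->
  (forall A B, measurable A -> measurable B ->
    P3 (tau @^-1` (A `*` B)) = P1 A * P2 B)%E ->
  preserving P3 (P1 \x P2)%E tau.
Proof.
move=> mtau H; split => // A mA.
pose m : {measure set (T1 * T2) -> \bar R} := pushforward P3 tau.
apply/esym; exact: (product_measure_unique (m' := m mtau) H mA).
Qed.

End product_preserving.

Section product_swap.
Context {d1 d2 : measure_display} {T1 : measurableType d1}
  {T2 : measurableType d2} {R : realType}.
Variables (P1 : probability T1 R) (P2 : probability T2 R).
Local Notation P12 := ((P1 \x P2)%E : probability (T1 * T2)%type R).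
Local Notation P21 := ((P2 \x P1)%E : probability (T2 * T1)%type R).

Lemma preserving_twist : preserving P21 P12 (fun z => (z.2, z.1)).
Proof.
have mt : measurable_fun setT (fun z : T2 * T1 => (z.2, z.1)).
  by apply/measurable_fun_pairP; split; [exact: measurable_snd|exact: measurable_fst].
apply: preserving_to_prod => // A B mA mB.
rewrite muleC -product_measure1E//; congr (_ _).
by apply/seteqP; split => -[x y]/= [].
Qed.

Variable h : T1 -> T2 -> R.
Hypothesis ih : L1 P12 (fun z => h z.1 z.2).

Lemma L1_twist : L1 P21 (fun z => h z.2 z.1).
Proof. exact: (preserving_L1 preserving_twist ih). Qed.

Lemma Rint_prod2 : \int[P12]_z h z.1 z.2 = \int[P2]_y \int[P1]_x h x y.
Proof.
rewrite (preserving_Rint preserving_twist ih)/=.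
exact: (Rint_prod (h := fun y x => h x y) L1_twist).
Qed.

End product_swap.

(** * Two covariance inequalities on a probability space *)

(** The determinant with rows (1, 1, 1), (X s, X t, X u) and
(phi s, phi t, phi u). If phi is a convex function of X, its sign depends only
on the order of X s, X t, X u. *)
Definition det3 {T : Type} {R : realType} (X phi : T -> R) (s t u : T) : R :=
  (X t - X s) * phi u + (X s - X u) * phi t + (X u - X t) * phi s.

Section covariance_inequalities.
Context {disp : measure_display} {T : measurableType disp} {R : realType}.
Variable P : probability T R.

Lemma Rint_lin5 (c1 c2 c3 c4 c5 : R) (h1 h2 h3 h4 h5 : T -> R) :
  L1 P h1 -> L1 P h2 -> L1 P h3 -> L1 P h4 -> L1 P h5 ->
  \int[P]_x (c1 * h1 x + c2 * h2 x + c3 * h3 x + c4 * h4 x + c5 * h5 x) =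
  c1 * \int[P]_x h1 x + c2 * \int[P]_x h2 x + c3 * \int[P]_x h3 x +
  c4 * \int[P]_x h4 x + c5 * \int[P]_x h5 x.
Proof.
move=> i1 i2 i3 i4 i5.
have m1 := L1_measurable i1; have m2 := L1_measurable i2.
have m3 := L1_measurable i3; have m4 := L1_measurable i4.
have m5 := L1_measurable i5.
by rewrite !RintD ?RintZ//; repeat apply: L1D; exact: L1Z.
Qed.

Section centered.
Variables X phi gam : T -> R.
Hypotheses (X2 : L2 P X) (phi2 : L2 P phi) (gam2 : L2 P gam).
Hypotheses (X0 : \int[P]_x X x = 0) (phi0 : \int[P]_x phi x = 0)
  (gam0 : \int[P]_x gam x = 0).

Let V := \int[P]_x (X x * X x).
Let M := \int[P]_x (phi x * gam x).
Let p := \int[P]_x (phi x * X x).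
Let q := \int[P]_x (X x * gam x).

(** As a function of any one of its three variables, the product of the
determinants of phi and gam has this form, so it can be integrated in one
variable after another by a single formula. *)
Let bil (a b c a' b' c' : R) (u : T) :=
  (a * phi u + b * X u + c) * (a' * gam u + b' * X u + c').

Let L2Z c h : L2 P h -> L2 P (fun x => c * h x).
Proof.
move=> [mh ih]; split; first exact: measurable_funM.
by under eq_fun do rewrite exprMn; exact: L1Z.
Qed.

Let L1_bil a b c a' b' c' : L1 P (bil a b c a' b' c').
Proof.
by apply: L2_mul; apply: L2D; try (exact: L2_cst); apply: L2D; exact: L2Z.
Qed.

Let Rint_bil a b c a' b' c' : \int[P]_u bil a b c a' b' c' u =
  a * a' * M + a * b' * p + b * a' * q + b * b' * V + c * c'.
Proof.
have iX := L2_L1 X2; have iphi := L2_L1 phi2; have igam := L2_L1 gam2.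
pose r u := a * c' * phi u + b * c' * X u + c * a' * gam u + c * b' * X u
  + c * c' * 1.
have ir : L1 P r by rewrite /r; repeat apply: L1D; apply: L1Z => //; exact: L1_cst.
transitivity (\int[P]_u (a * a' * (phi u * gam u) + a * b' * (phi u * X u) +
   b * a' * (X u * gam u) + b * b' * (X u * X u) + 1 * r u)).
  by apply: eq_Rintegral => u _; rewrite /bil /r; ring.
rewrite Rint_lin5//; try exact: L2_mul.
rewrite /r Rint_lin5//; last exact: L1_cst.
by rewrite -/M -/p -/q -/V X0 phi0 gam0 Rint_cst; ring.
Qed.

(** The integral of the product of the two determinants over three independent
copies is 6 times the determinant of the matrix of scalar products of
(1, X, phi) with (1, X, gam) (Andreief's identity); this matrix has
determinant V M - p q when all the functions are centered. *)
Lemma covariance_regression_centered :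
  (forall s t u, 0 <= det3 X phi s t u * det3 X gam s t u) -> p * q <= V * M.
Proof.
move=> det_ge0.
(* Q s t is the integral over u of the product of the determinants, again a
   combination of products bil as a function of t. *)
pose Q s t :=
  M * bil 0 1 (- X s) 0 1 (- X s) t
  + p * bil 0 1 (- X s) (-1) 0 (gam s) t
  + q * bil (-1) 0 (phi s) 0 1 (- X s) t
  + V * bil (-1) 0 (phi s) (-1) 0 (gam s) t
  + 1 * bil (X s) (- phi s) 0 (X s) (- gam s) 0 t.
have Q_ge0 s t : 0 <= Q s t.
  suff -> : Q s t = \int[P]_u (det3 X phi s t u * det3 X gam s t u).
    by apply: Rintegral_ge0 => u _; exact: det_ge0.
  transitivity (\int[P]_u bil (X t - X s) (phi s - phi t)
      (X s * phi t - X t * phi s) (X t - X s) (gam s - gam t)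
      (X s * gam t - X t * gam s) u).
    by rewrite Rint_bil /Q /bil; ring.
  by apply: eq_Rintegral => u _; rewrite /bil /det3; ring.
pose S s := \int[P]_t Q s t.
have S_ge0 s : 0 <= S s by apply: Rintegral_ge0 => t _; exact: Q_ge0.
have SE s : S s = 2 * M * (X s * X s) + - 2 * p * (X s * gam s)
    + - 2 * q * (phi s * X s) + 2 * V * (phi s * gam s)
    + (2 * (V * M - p * q)) * 1.
  rewrite /S /Q Rint_lin5//; try exact: L1_bil.
  by rewrite !Rint_bil; ring.
have : 0 <= \int[P]_s S s by apply: Rintegral_ge0 => s _; exact: S_ge0.
under eq_Rintegral do rewrite SE.
rewrite Rint_lin5//; try exact: L2_mul; last exact: L1_cst.
rewrite -/V -/M -/p -/q Rint_cst; lra.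
Qed.

End centered.

(** The covariance of phi and gam is at least the covariance of their linear
regressions on X. The determinants do not change when constants are added to
phi and gam, which reduces this to the centered case. *)
Lemma covariance_regression (X phi gam : T -> R) :
  L2 P X -> L2 P phi -> L2 P gam -> \int[P]_x X x = 0 ->
  (forall s t u, 0 <= det3 X phi s t u * det3 X gam s t u) ->
  \int[P]_x (phi x * X x) * \int[P]_x (gam x * X x) <=
  \int[P]_x (X x ^+ 2) *
    (\int[P]_x (phi x * gam x) - \int[P]_x phi x * \int[P]_x gam x).
Proof.
move=> X2 phi2 gam2 X0 det_ge0.
have iX := L2_L1 X2; have iphi := L2_L1 phi2; have igam := L2_L1 gam2.
pose center (h : T -> R) x := h x + - \int[P]_y h y.
have center2 h : L2 P h -> L2 P (center h).
  by move=> h2; apply: L2D => //; exact: L2_cst.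
have center0 h : L2 P h -> \int[P]_x center h x = 0.
  by move=> h2; rewrite RintD ?Rint_cst ?subrr//; [exact: L2_L1|exact: L1_cst].
have := covariance_regression_centered X2 (center2 _ phi2) (center2 _ gam2) X0
  (center0 _ phi2) (center0 _ gam2).
have -> : \int[P]_x (center phi x * X x) = \int[P]_x (phi x * X x).
  rewrite /center; under eq_Rintegral do rewrite mulrDl.
  rewrite RintD//; [|exact: L2_mul|exact: L1Z].
  by rewrite RintZ ?X0 ?mulr0 ?addr0//; exact: L1_measurable iX.
have -> : \int[P]_x (X x * center gam x) = \int[P]_x (gam x * X x).
  rewrite /center; under eq_Rintegral do rewrite mulrC mulrDl.
  rewrite RintD//; [|exact: L2_mul|exact: L1Z].
  by rewrite RintZ ?X0 ?mulr0 ?addr0//; exact: L1_measurable iX.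
have -> : \int[P]_x (center phi x * center gam x) =
    \int[P]_x (phi x * gam x) - \int[P]_x phi x * \int[P]_x gam x.
  pose A := \int[P]_x phi x; pose B := \int[P]_x gam x.
  transitivity (\int[P]_x (1 * (phi x * gam x) + - B * phi x + - A * gam x
      + A * B * 1 + 0 * 1)).
    by apply: eq_Rintegral => x _; rewrite /center -/A -/B; ring.
  rewrite Rint_lin5//; try exact: L1_cst; last exact: L2_mul.
  by rewrite Rint_cst -/A -/B; ring.
apply => s t u.
rewrite [X in 0 <= X](_ : _ = det3 X phi s t u * det3 X gam s t u)//.
by rewrite /det3 /center; ring.
Qed.

(** Integrated over two independent copies, the product of the increments of X
and K gives twice the integral of X K, as X is centered. The comparison is
required on a set of full measure only, because the K of interest is itself
given by an integral that may diverge at exceptional points. *)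
Lemma chebyshev_association (X K : T -> R) (good : set T) :
  L1 P X -> L1 P K -> L1 P (fun t => X t * K t) -> \int[P]_t X t = 0 ->
  {ae P, forall t, good t} ->
  (forall s t, good s -> good t -> 0 <= (X s - X t) * (K s - K t)) ->
  0 <= \int[P]_t (X t * K t).
Proof.
move=> iX iK iXK X0 good_ae mono.
have iS s : L1 P (fun t => (X s - X t) * (K s - K t)).
  apply: (eq_integrable _ (EFin \o (fun t =>
    X s * K s + - X s * K t + - K s * X t + X t * K t))) => //.
    by move=> t _ /=; congr EFin; ring.
  by repeat apply: L1D => //; try exact: L1_cst; exact: L1Z.
have SE s : \int[P]_t ((X s - X t) * (K s - K t)) =
    1 * (X s * K s) + - (\int[P]_t K t) * X s + (\int[P]_t (X t * K t)) * 1
    + 0 * 1 + 0 * 1.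
  transitivity (\int[P]_t (1 * (X t * K t) + - X s * K t + - K s * X t
     + X s * K s * 1 + 0 * 1)).
    by apply: eq_Rintegral => t _; ring.
  rewrite Rint_lin5//; try exact: L1_cst.
  by rewrite X0 Rint_cst; ring.
have : 0 <= \int[P]_s (1 * (X s * K s) + - (\int[P]_t K t) * X s
    + (\int[P]_t (X t * K t)) * 1 + 0 * 1 + 0 * 1).
  rewrite -[leLHS](Rint_cst P); apply: ae_le_Rint; first exact: L1_cst.
    by repeat apply: L1D; apply: L1Z => //; exact: L1_cst.
  apply: (filterS _ good_ae) => s gs; rewrite -SE -[leLHS](Rint_cst P).
  apply: ae_le_Rint => //; first exact: L1_cst.
  by apply: filterS good_ae => t gt; exact: mono.
rewrite Rint_lin5//; try exact: L1_cst.
by rewrite X0 Rint_cst; lra.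
Qed.

End covariance_inequalities.

(** * The four functions property *)

Section four_functions_ereal.
Context {R : realType}.
Local Open Scope ereal_scope.

(** From (c - a) (c - b) >= 0 one gets c (a + b) <= c^2 + a b <= c (c + d). *)
Lemma add_le_of_mul_le (a b c d : \bar R) : 0 <= a -> 0 <= b -> 0 <= c ->
  0 <= d -> a <= c -> b <= c -> a * b <= c * d -> a + b <= c + d.
Proof.
case: c => [c| |] //=; last first.
  by move=> _ _ _ d0 _ _ _; rewrite addye ?leey// gt_eqF// (lt_le_trans _ d0).
case: a => [a| |] //; case: b => [b| |] //.
rewrite !lee_fin => a0 b0 c0 d0 ac bc; have [c_eq0|c_neq0] := eqVneq c 0%R.
  have -> : a = 0%R by lra. have -> : b = 0%R by lra.
  by rewrite c_eq0 !add0e.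
have {}c_neq0 : (0 < c)%R by rewrite lt_neqAle eq_sym c_neq0.
case: d d0 => [d| |] // d0 abcd; last by rewrite addey ?leey.
have {}abcd : (a * b <= c * d)%R by rewrite -lee_fin.
by rewrite -!EFinD lee_fin; nra.
Qed.

Lemma double_le (x y : \bar R) : 0 <= x -> 0 <= y -> x + x <= y + y -> x <= y.
Proof.
case: y => [y| |] //; case: x => [x| |] //; rewrite ?leey// -?EFinD !lee_fin.
lra.
Qed.

End four_functions_ereal.

Section four_functions.
Context {disp : measure_display} {T : measurableType disp} {R : realType}.
Variable P : probability T R.
Local Open Scope ereal_scope.

(** The Ahlswede-Daykin inequality, as a property of P with respect to two
operations, so that it can be passed to product measures. With extended real
values the partial integrals of the four functions remain admissible. *)
Definition four_functions (join meet : T -> T -> T) : Prop :=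
  forall a b c d : T -> \bar R,
    measurable_fun setT a -> measurable_fun setT b ->
    measurable_fun setT c -> measurable_fun setT d ->
    (forall x, 0 <= a x) -> (forall x, 0 <= b x) ->
    (forall x, 0 <= c x) -> (forall x, 0 <= d x) ->
    (forall x y, a x * b y <= c (join x y) * d (meet x y)) ->
  (\int[P]_x a x) * (\int[P]_x b x) <= (\int[P]_x c x) * (\int[P]_x d x).

(** The totally ordered case. The integrals over two independent copies are
compared after symmetrization: exchanging the copies turns the claim into
a s b t + a t b s <= c s d t + c t d s, which is add_le_of_mul_le. The order is
read off a function ord because the relevant functions depend on one
coordinate of a vector. *)
Lemma four_functions_chain (ord : T -> R) (a b c d : T -> \bar R) :
    measurable_fun setT a -> measurable_fun setT b ->
    measurable_fun setT c -> measurable_fun setT d ->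
    (forall x, 0 <= a x) -> (forall x, 0 <= b x) ->
    (forall x, 0 <= c x) -> (forall x, 0 <= d x) ->
    (forall s t, (ord t <= ord s)%R ->
      a s * b t <= c s * d t /\ a t * b s <= c s * d t) ->
  (\int[P]_x a x) * (\int[P]_x b x) <= (\int[P]_x c x) * (\int[P]_x d x).
Proof.
move=> ma mb mc md a0 b0 c0 d0 H.
have pointwise s t : a s * b t + a t * b s <= c s * d t + c t * d s.
  wlog ts : s t / (ord t <= ord s)%R.
    move=> wl; case/orP: (le_total (ord t) (ord s)) => ?; first exact: wl.
    by rewrite addeC [leRHS]addeC; exact: wl.
  have [H1 H2] := H s t ts.
  apply: add_le_of_mul_le => //; do ?exact: mule_ge0.
  rewrite (_ : a s * b t * (a t * b s) = (a s * b s) * (a t * b t)); last first.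
    by rewrite muleACA [b t * b s]muleC -muleACA.
  rewrite (_ : c s * d t * (c t * d s) = (c s * d s) * (c t * d t)); last first.
    by rewrite muleACA [d t * d s]muleC -muleACA.
  have [H3 _] := H s s (lexx _); have [H4 _] := H t t (lexx _).
  by apply: lee_pmul => //; exact: mule_ge0.
have double (u v : T -> \bar R) :
    measurable_fun setT u -> measurable_fun setT v ->
    (forall x, 0 <= u x) -> (forall x, 0 <= v x) ->
    \int[P]_s \int[P]_t (u s * v t + u t * v s) =
    (\int[P]_x u x) * (\int[P]_x v x) + (\int[P]_x u x) * (\int[P]_x v x).
  move=> mu mv u0 v0.
  have U0 : 0 <= \int[P]_x u x by exact: integral_ge0.
  have V0 : 0 <= \int[P]_x v x by exact: integral_ge0.
  under eq_integral => s _.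
    rewrite ge0_integralD//; [|by move=> *; exact: mule_ge0|
      by apply: emeasurable_funM|by move=> *; exact: mule_ge0|
      by apply: emeasurable_funM].
    rewrite ge0_integralZl// ge0_integralZr//.
    over.
  rewrite ge0_integralD//; [|by move=> *; exact: mule_ge0|
      by apply: emeasurable_funM|by move=> *; exact: mule_ge0|
      by apply: emeasurable_funM].
  by rewrite ge0_integralZr// ge0_integralZl.
apply: double_le; [by apply: mule_ge0; exact: integral_ge0..|].
rewrite -double// -double//.
have mprod (u v : T -> \bar R) : measurable_fun setT u -> measurable_fun setT v ->
    measurable_fun setT (fun z : T * T => u z.1 * v z.2 + u z.2 * v z.1).
  move=> mu mv; apply: emeasurable_funD; apply: emeasurable_funM;
  exact: measurableT_comp.
have msec (u v : T -> \bar R) s : measurable_fun setT u -> measurable_fun setT v ->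
    measurable_fun setT (fun t => u s * v t + u t * v s).
  by move=> mu mv; apply: emeasurable_funD; apply: emeasurable_funM.
have pos (u v : T -> \bar R) s t : (forall x, 0 <= u x) -> (forall x, 0 <= v x) ->
    0 <= u s * v t + u t * v s.
  by move=> u0 v0; apply: adde_ge0; exact: mule_ge0.
apply: ge0_le_integral => //.
- by move=> s _; apply: integral_ge0 => t _; exact: pos.
- apply: (measurable_fun_fubini_tonelli_F (fun z : T * T => a z.1 * b z.2 + a z.2 * b z.1)).
    exact: mprod.
  by move=> z; exact: pos.
- apply: (measurable_fun_fubini_tonelli_F (fun z : T * T => c z.1 * d z.2 + c z.2 * d z.1)).
    exact: mprod.
  by move=> z; exact: pos.
- move=> s _; apply: ge0_le_integral => //; do ?exact: msec.
  by move=> t _; exact: pos.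
Qed.

End four_functions.

Section four_functions_prod.
Context {d1 d2 : measure_display} {T1 : measurableType d1}
  {T2 : measurableType d2} {R : realType}.
Variables (P1 : probability T1 R) (P2 : probability T2 R).
Local Open Scope ereal_scope.

(** The inequality for P2, applied to sections, says that the partial integrals
over the second factor satisfy the hypothesis for P1. *)
Lemma four_functions_prod (j1 m1 : T1 -> T1 -> T1) (j2 m2 : T2 -> T2 -> T2) :
  four_functions P1 j1 m1 -> four_functions P2 j2 m2 ->
  four_functions (P1 \x P2) (fun x y => (j1 x.1 y.1, j2 x.2 y.2))
    (fun x y => (m1 x.1 y.1, m2 x.2 y.2)).
Proof.
move=> ff1 ff2 a b c d ma mb mc md a0 b0 c0 d0 H.
have msec (u : T1 * T2 -> \bar R) x : measurable_fun setT u ->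
    measurable_fun setT (fun y => u (x, y)).
  move=> mu; exact: measurableT_comp.
rewrite !fubini_tonelli1//; apply: ff1.
1-4: exact: measurable_fun_fubini_tonelli_F.
1-4: by move=> x; exact: integral_ge0.
by move=> x y; apply: ff2; auto => u v; exact: (H (x, u) (y, v)).
Qed.

End four_functions_prod.

(** * The FKG inequality *)

Section fkg.
Context {disp : measure_display} {T : measurableType disp} {R : realType}.
Variables (P : probability T R) (join meet : T -> T -> T).
Hypothesis ff : four_functions P join meet.

Definition increasing_for (h : T -> R) : Prop :=
  forall x y, h x <= h (join x y) /\ h y <= h (join x y).

Definition log_supermodular (F : T -> R) : Prop :=
  forall x y, F x * F y <= F (join x y) * F (meet x y).

Lemma increasing_for_max (h : T -> R) c :
  increasing_for h -> increasing_for (fun x => Num.max (h x) c).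
Proof.
move=> hi x y; have [h1 h2] := hi x y.
by split; rewrite ge_max !le_max ?h1 ?h2 ?lexx ?orbT.
Qed.

Variable F : T -> R.
Hypotheses (F0 : forall x, 0 <= F x) (iF : L1 P F) (lsmF : log_supermodular F).

(** The four functions are F h1, F h2, F h1 h2 and F. *)
Lemma fkg_ge0 (h1 h2 : T -> R) :
    increasing_for h1 -> increasing_for h2 ->
    (forall x, 0 <= h1 x) -> (forall x, 0 <= h2 x) ->
    L1 P (fun x => F x * h1 x) -> L1 P (fun x => F x * h2 x) ->
    L1 P (fun x => F x * (h1 x * h2 x)) ->
  \int[P]_x (F x * h1 x) * \int[P]_x (F x * h2 x) <=
  \int[P]_x F x * \int[P]_x (F x * (h1 x * h2 x)).
Proof.
move=> hi1 hi2 h10 h20 i1 i2 i12.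
rewrite -lee_fin !EFinM !L1_fineK// [leRHS]muleC.
apply: ff; try (by apply/measurable_EFinP; apply: L1_measurable; eassumption);
  try by move=> x; rewrite lee_fin; do ?apply: mulr_ge0.
move=> x y; rewrite -!EFinM lee_fin.
have [h1x _] := hi1 x y; have [_ h2y] := hi2 x y.
rewrite mulrACA [leRHS](_ : _ = (F (join x y) * F (meet x y)) *
  (h1 (join x y) * h2 (join x y))); last by ring.
by apply: ler_pM => //; [exact: mulr_ge0|exact: mulr_ge0|exact: ler_pM].
Qed.

Lemma norm_max_le (a c : R) : c <= 0 -> `|Num.max a c| <= `|a|.
Proof.
move=> c0; rewrite maxEle; case: ifPn => // ac.
by rewrite !ler0_norm ?lerN2//; exact: le_trans ac c0.
Qed.

Lemma L1_max (h : T -> R) (c : R) : measurable_fun setT h ->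
  L1 P (fun x => F x * h x) -> c <= 0 -> L1 P (fun x => F x * Num.max (h x) c).
Proof.
move=> mh ih c0; apply: (le_integrable measurableT _ _ ih).
  apply/measurable_EFinP/measurable_funM; first exact: L1_measurable iF.
  by apply: measurable_maxr.
move=> x _ /=; rewrite lee_fin !normrM ler_wpM2l//; exact: norm_max_le.
Qed.

(** Adding k to h1 and h2 makes them nonnegative and adds the same amount to
both sides. *)
Lemma fkg_bounded_below (h1 h2 : T -> R) (k : R) : 0 <= k ->
    increasing_for h1 -> increasing_for h2 ->
    (forall x, - k <= h1 x) -> (forall x, - k <= h2 x) ->
    L1 P (fun x => F x * h1 x) -> L1 P (fun x => F x * h2 x) ->
    L1 P (fun x => F x * (h1 x * h2 x)) ->
  \int[P]_x (F x * h1 x) * \int[P]_x (F x * h2 x) <=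
  \int[P]_x F x * \int[P]_x (F x * (h1 x * h2 x)).
Proof.
move=> k0 hi1 hi2 k1 k2 i1 i2 i12.
have lin (h : T -> R) : L1 P (fun x => F x * h x) ->
    L1 P (fun x => F x * (h x + k)) /\
    \int[P]_x (F x * (h x + k)) = \int[P]_x (F x * h x) + k * \int[P]_x F x.
  move=> ih; have E x : F x * (h x + k) = F x * h x + k * F x by ring.
  split; first by under eq_fun do rewrite E; apply: L1D => //; exact: L1Z.
  under eq_Rintegral do rewrite E.
  by rewrite RintD ?RintZ//; [exact: L1_measurable iF|exact: L1Z].
have [j1 e1] := lin _ i1; have [j2 e2] := lin _ i2.
have E x : F x * ((h1 x + k) * (h2 x + k)) =
  1 * (F x * (h1 x * h2 x)) + k * (F x * h1 x) + k * (F x * h2 x)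
   + k * k * F x + 0 * F x by ring.
have j12 : L1 P (fun x => F x * ((h1 x + k) * (h2 x + k))).
  under eq_fun do rewrite E; repeat apply: L1D; exact: L1Z.
have inc (h : T -> R) : increasing_for h -> increasing_for (fun x => h x + k).
  by move=> hi x y; have [? ?] := hi x y; split; rewrite lerD2r.
have pos (h : T -> R) : (forall x, - k <= h x) -> forall x, 0 <= h x + k.
  by move=> kh x; rewrite -lerBlDr sub0r.
have := fkg_ge0 (inc _ hi1) (inc _ hi2) (pos _ k1) (pos _ k2) j1 j2 j12.
under [X in _ <= _ * X]eq_Rintegral do rewrite E.
by rewrite Rint_lin5// e1 e2; lra.
Qed.

Lemma Rint_cvg_trunc (u_ : nat -> T -> R) (u : T -> R) :
  (forall n, measurable_fun setT (u_ n)) -> L1 P u ->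
  (forall n x, `|u_ n x| <= `|u x|) ->
  (forall x, \forall n \near \oo, u_ n x = u x) ->
  \int[P]_x u_ n x @[n --> \oo] --> \int[P]_x u x.
Proof.
move=> mu_ iu uu ucvg; apply: fine_cvg; rewrite L1_fineK//.
apply: (@dominated_cvg _ _ _ P setT measurableT _ _ (fun x => `|u x|%:E)) => //.
- by move=> n; exact/measurable_EFinP.
- move=> x _; apply: cvg_near_cst; apply: filterS (ucvg x) => n ->//.
- exact: integrable_norm.
- by move=> n x _; rewrite lee_fin.
Qed.

(** The functions h1 and h2 are truncated from below, which keeps them
increasing; the bound is then removed by dominated convergence. *)
Lemma fkg (h1 h2 : T -> R) :
    measurable_fun setT h1 -> measurable_fun setT h2 ->
    increasing_for h1 -> increasing_for h2 ->
    L1 P (fun x => F x * h1 x) -> L1 P (fun x => F x * h2 x) ->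
    L1 P (fun x => F x * (h1 x * h2 x)) ->
  \int[P]_x (F x * h1 x) * \int[P]_x (F x * h2 x) <=
  \int[P]_x F x * \int[P]_x (F x * (h1 x * h2 x)).
Proof.
move=> mh1 mh2 hi1 hi2 i1 i2 i12.
pose tr (h : T -> R) (n : nat) x := Num.max (h x) (- n%:R).
have mF := L1_measurable iF.
have mtr h n : measurable_fun setT h -> measurable_fun setT (tr h n).
  by move=> mh; apply: measurable_maxr.
have tr_le h n x : `|tr h n x| <= `|h x| by apply: norm_max_le; rewrite oppr_le0.
have tr_near h x : \forall n \near \oo, tr h n x = h x.
  near=> n; rewrite /tr; apply/max_idPl; rewrite lerNl.
  by near: n; exact: nbhs_infty_ger.
have itr12 n : L1 P (fun x => F x * (tr h1 n x * tr h2 n x)).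
  apply: (le_integrable measurableT _ _ i12).
    by apply/measurable_EFinP/measurable_funM => //; apply: measurable_funM; exact: mtr.
  by move=> x _ /=; rewrite lee_fin !normrM ler_wpM2l// ler_pM.
have step n : \int[P]_x (F x * tr h1 n x) * \int[P]_x (F x * tr h2 n x) <=
  \int[P]_x F x * \int[P]_x (F x * (tr h1 n x * tr h2 n x)).
  apply: (@fkg_bounded_below _ _ n%:R) => //; try exact: increasing_for_max.
  - by move=> x; rewrite /tr le_max lexx orbT.
  - by move=> x; rewrite /tr le_max lexx orbT.
  - by apply: L1_max; rewrite ?oppr_le0.
  - by apply: L1_max; rewrite ?oppr_le0.
have cvg1 (h : T -> R) : measurable_fun setT h -> L1 P (fun x => F x * h x) ->
    \int[P]_x (F x * tr h n x) @[n --> \oo] --> \int[P]_x (F x * h x).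
  move=> mh ih; apply: Rint_cvg_trunc => //.
  - by move=> n; apply: measurable_funM => //; exact: mtr.
  - by move=> n x; rewrite !normrM ler_wpM2l.
  - by move=> x; apply: filterS (tr_near h x) => n ->.
apply: (ler_cvg_to (cvgM (cvg1 _ mh1 i1) (cvg1 _ mh2 i2))).
  apply: (cvgM (cvg_cst _)); apply: (@Rint_cvg_trunc
    (fun n x => F x * (tr h1 n x * tr h2 n x)) _ _ i12).
  - by move=> n; exact: L1_measurable (itr12 n).
  - by move=> n x; rewrite !normrM ler_wpM2l// ler_pM.
  - move=> x; have := tr_near h1 x; have := tr_near h2 x.
    by apply: filterS2 => n -> ->.
by near=> n; exact: step.
Unshelve. all: by end_near.
Qed.

End fkg.

(** * Exchanging coordinates of two independent vectors *)

Section row_vectors.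
Context {R : realType} {d : nat}.
Local Notation V := 'rV[R]_d.
Implicit Types (x y w : V) (S : pred 'I_d) (k : 'I_d).

Definition mix S w x : V := \row_i (if S i then w ord0 i else x ord0 i).

Definition rv_join x y : V := \row_i Num.max (x ord0 i) (y ord0 i).

Definition rv_meet x y : V := \row_i Num.min (x ord0 i) (y ord0 i).

Lemma mixE S w x i : mix S w x ord0 i = if S i then w ord0 i else x ord0 i.
Proof. by rewrite mxE. Qed.

Lemma eq_rV x y : (forall i, x ord0 i = y ord0 i) -> x = y.
Proof. by move=> xy; apply/rowP. Qed.

Lemma mix0 S w x : (forall i, ~~ S i) -> mix S w x = x.
Proof. by move=> S0; apply: eq_rV => i; rewrite mixE (negbTE (S0 i)). Qed.

Lemma mixT S w x : (forall i, S i) -> mix S w x = w.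
Proof. by move=> ST; apply: eq_rV => i; rewrite mixE ST. Qed.

Definition box (A : 'I_d -> set R) : set V := [set x | forall i, A i (x ord0 i)].

Lemma measurable_coord (i : 'I_d) : measurable_fun setT (fun x : V => x ord0 i).
Proof.
move=> _ Y mY; rewrite setTI; apply: sub_sigma_algebra => /=.
rewrite -bigcup_seq/=; exists i => /=; first by rewrite mem_index_enum.
by exists Y => //; rewrite setTI.
Qed.

(** Induction principle for the sigma-algebra generated by the coordinates. *)
Lemma coord_systemP (Q : set (set V)) :
  (forall i (A : set R), measurable A -> Q ((fun x : V => x ord0 i) @^-1` A)) ->
  sigma_algebra setT Q -> measurable `<=` Q.
Proof.
move=> QA sQ; apply: smallest_sub => // B.
rewrite -bigcup_seq/= => -[i _ [A mA <-]].
by rewrite setTI; exact: QA.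
Qed.

Lemma measurable_rV {disp} {T : measurableType disp} (f : T -> V) :
  (forall i, measurable_fun setT (fun t => f t ord0 i)) -> measurable_fun setT f.
Proof.
move=> mf _ A; rewrite setTI.
have sQ : sigma_algebra setT (image_set_system setT f (@measurable _ T)).
  exact/sigma_algebra_image/sigma_algebra_measurable.
have Qcoord i (B : set R) : measurable B ->
    image_set_system setT f (@measurable _ T) ((fun x : V => x ord0 i) @^-1` B).
  by move=> mB; exact: mf.
move=> mA; have := coord_systemP Qcoord sQ mA.
by rewrite /image_set_system/= setTI.
Qed.

Lemma measurable_mix S : measurable_fun setT (fun z : V * V => mix S z.1 z.2).
Proof.
apply: measurable_rV => i; under eq_fun do rewrite mixE.
by case: (S i); [exact: (measurableT_comp (measurable_coord i) measurable_fst)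
  |exact: (measurableT_comp (measurable_coord i) measurable_snd)].
Qed.

Lemma measurable_box A : (forall i, measurable (A i)) -> measurable (box A).
Proof.
move=> mA; rewrite (_ : box A = \bigcap_(i in [set: 'I_d]) ((fun x : V => x ord0 i) @^-1` A i)).
  apply: fin_bigcap_measurable; first exact: finite_finset.
  by move=> i _; rewrite -[X in measurable X]setTI; exact: measurable_coord.
by apply/seteqP; split => [x Ax i _|x Ax i]; [exact: Ax|exact: (Ax i I)].
Qed.

(** A pi-system for the uniqueness of measures on pairs of vectors. *)
Definition boxes : set (set (V * V)) :=
  [set C | exists A B, [/\ forall i, measurable (A i),
     forall i, measurable (B i) & C = box A `*` box B]].

Lemma measurable_boxes : @measurable _ (V * V)%type `<=` <<s boxes >>.
Proof.
have bT : box (fun=> setT) = setT by apply/seteqP; split.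
apply: smallest_sub; first exact: smallest_sigma_algebra.
have sQ (h : V * V -> V) : sigma_algebra setT (image_set_system setT h <<s boxes >>).
  exact/sigma_algebra_image/smallest_sigma_algebra.
have bE i (A : set R) : (fun x : V => x ord0 i) @^-1` A =
    box (fun j => if j == i then A else setT).
  apply/seteqP; split => [x Ax j /=|x /(_ i)]; last by rewrite eqxx.
  by case: eqVneq => // ->.
have bm i (A : set R) : measurable A ->
    forall j, measurable (if j == i :> 'I_d then A else setT).
  by move=> mA j; case: ifP.
move=> C [] [A mA <-].
- have := coord_systemP _ (sQ fst) mA; rewrite /image_set_system/=; apply.
  move=> i B mB /=; rewrite setTI; apply: sub_sigma_algebra.
  exists (fun j => if j == i then B else setT), (fun=> setT).
  split=> //; first exact: bm.
  by rewrite -bE bT; apply/seteqP; split => -[x y]//= [].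
- have := coord_systemP _ (sQ snd) mA; rewrite /image_set_system/=; apply.
  move=> i B mB /=; rewrite setTI; apply: sub_sigma_algebra.
  exists (fun=> setT), (fun j => if j == i then B else setT).
  split=> //; first exact: bm.
  by rewrite -bE bT; apply/seteqP; split => -[x y]//= [].
Qed.

Variables (mus : 'I_d -> probability R R) (mu : probability V R).
Hypothesis mu_prod : is_product_probability mus mu.

(** All coordinates of two independent vectors of law mu are independent, and
their i-th coordinates have the same law; hence exchanging the coordinates in S
preserves the joint law. Apart from the second moments, this is what the
product structure contributes to the correlation inequalities. *)
Lemma preserving_swap S :
  preserving (mu \x mu)%E (mu \x mu)%E
    (fun z : V * V => (mix S z.2 z.1, mix S z.1 z.2)).
Proof.
have mswap : measurable_fun setT
    (fun z : V * V => (mix S z.2 z.1, mix S z.1 z.2)).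
  apply/measurable_fun_pairP; split; last exact: measurable_mix.
  have mtwist : measurable_fun setT (fun z : V * V => (z.2, z.1)).
    by apply/measurable_fun_pairP; split; [exact: measurable_snd|exact: measurable_fst].
  exact: (measurableT_comp (measurable_mix S) mtwist).
split=> // A mA.
pose m : {measure set (V * V) -> \bar R} :=
  pushforward (mu \x mu)%E (fun z : V * V => (mix S z.2 z.1, mix S z.1 z.2)).
have mbox B : boxes B -> measurable B.
  by move=> [A1 [A2 [mA1 mA2 ->]]]; apply: measurableX; exact: measurable_box.
have boxT : boxes setT.
  exists (fun=> setT), (fun=> setT); split=> //.
  by apply/seteqP; split.
apply: (@g_sigma_algebra_measure_unique _ R _ boxes mbox (fun=> setT) _ _
  (m mswap) (mu \x mu)%E) => //.
- by rewrite bigcup_const//; exists 0%N.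
- move=> _ _ [A1 [A2 [mA1 mA2 ->]]] [B1 [B2 [mB1 mB2 ->]]].
  exists (fun i => A1 i `&` B1 i), (fun i => A2 i `&` B2 i); split.
  + by move=> i; exact: measurableI.
  + by move=> i; exact: measurableI.
  + apply/seteqP; split => -[x y].
      by move=> [[/= a1 a2] [/= b1 b2]]; split => i; split; [exact: a1|exact: b1|exact: a2|exact: b2].
    by move=> [/= c1 c2]; split; split => i /=; [case: (c1 i)|case: (c2 i)|case: (c1 i)|case: (c2 i)].
- move=> _ [A1 [A2 [mA1 mA2 ->]]].
  pose C1 i := if S i then A2 i else A1 i.
  pose C2 i := if S i then A1 i else A2 i.
  have mC1 i : measurable (C1 i) by rewrite /C1; case: ifP.
  have mC2 i : measurable (C2 i) by rewrite /C2; case: ifP.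
  transitivity ((mu \x mu)%E (box C1 `*` box C2)).
    rewrite /m/= /pushforward; congr (_ _).
    apply/seteqP; split => -[x y] [/= b1 b2]; split => i /=.
    + by move: (b1 i) (b2 i); rewrite /C1 !mixE; case: ifP.
    + by move: (b1 i) (b2 i); rewrite /C2 !mixE; case: ifP.
    + by move: (b1 i) (b2 i); rewrite /C1 /C2 !mixE; case: ifP.
    + by move: (b1 i) (b2 i); rewrite /C1 /C2 !mixE; case: ifP.
  have mbC1 := measurable_box mC1; have mbC2 := measurable_box mC2.
  have mbA1 := measurable_box mA1; have mbA2 := measurable_box mA2.
  transitivity (mu (box A1) * mu (box A2))%E; last exact/esym/product_measure1E.
  rewrite product_measure1E//.
  transitivity ((\prod_(i < d) mus i (C1 i)) * (\prod_(i < d) mus i (C2 i)))%E.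
    by congr (_ * _)%E; exact: mu_prod.
  transitivity ((\prod_(i < d) mus i (A1 i)) * (\prod_(i < d) mus i (A2 i)))%E; last first.
    by congr (_ * _)%E; apply/esym; exact: mu_prod.
  rewrite -!big_split; apply: eq_bigr => i _ /=.
  by rewrite /C1 /C2; case: ifP => // _; rewrite muleC.
- by move=> k; rewrite /m/= /pushforward preimage_setT probability_setT ltry.
- exact: measurable_boxes.
Qed.

Lemma preserving_coord (k : 'I_d) : preserving mu (mus k) (fun x : V => x ord0 k).
Proof.
split; first exact: measurable_coord.
move=> A mA.
rewrite (_ : _ @^-1` _ = box (fun i => if i == k then A else setT)); last first.
  apply/seteqP; split => [x Ax j /=|x /(_ k)]; last by rewrite eqxx.
  by case: eqVneq => // ->.
rewrite mu_prod; last by move=> i; case: ifP.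
rewrite (bigD1 k)//= eqxx big1 ?mule1// => i /negbTE ->.
exact: probability_setT.
Qed.

End row_vectors.

(** * The four functions theorem for product measures *)

Section resampling.
Context {R : realType} {d : nat}.
Local Notation V := 'rV[R]_d.
Implicit Types (x y w s t : V) (S : pred 'I_d) (k : 'I_d).

Definition swap_invariant (mu : probability V R) : Prop :=
  forall S, preserving (mu \x mu)%E (mu \x mu)%E
    (fun z : V * V => (mix S z.2 z.1, mix S z.1 z.2)).

Variable mu : probability V R.
Hypothesis mu_swap : swap_invariant mu.

Lemma preserving_mixr S :
  preserving (mu \x mu)%E mu (fun z : V * V => mix S z.2 z.1).
Proof. exact: (preserving_comp (preserving_fst mu mu) (mu_swap S)). Qed.

Section average.
Local Open Scope ereal_scope.

(** Integrating out the k-th coordinate. It is resampled from a whole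
independent vector, which avoids lower-dimensional marginals of mu. *)
Let average k (a : V -> \bar R) x := \int[mu]_s a (mix (pred1 k) s x).

Let mcomp k (a : V -> \bar R) : measurable_fun setT a ->
  measurable_fun setT (fun z : V * V => a (mix (pred1 k) z.2 z.1)).
Proof.
by move=> ma; apply: measurableT_comp => //; case: (preserving_mixr (pred1 k)).
Qed.

Let measurable_average k a : measurable_fun setT a -> (forall x, 0 <= a x) ->
  measurable_fun setT (average k a).
Proof.
move=> ma a0; apply: (measurable_fun_fubini_tonelli_F
  (fun z : V * V => a (mix (pred1 k) z.2 z.1))) => //.
exact: mcomp.
Qed.

Let integral_average k a : measurable_fun setT a -> (forall x, 0 <= a x) ->
  \int[mu]_x a x = \int[mu]_x average k a x.
Proof.
move=> ma a0; rewrite (preserving_ge0_integral (preserving_mixr (pred1 k)))//.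
by rewrite fubini_tonelli1//; exact: mcomp.
Qed.

Let msec k (a : V -> \bar R) x : measurable_fun setT a ->
  measurable_fun setT (fun s => a (mix (pred1 k) s x)).
Proof. by move=> /(mcomp k) ma; exact: (measurableT_comp ma (pair1_measurable x)). Qed.

Lemma rv_join_mix k s t x y : (t ord0 k <= s ord0 k)%R ->
  rv_join (mix (pred1 k) s x) (mix (pred1 k) t y) = mix (pred1 k) s (rv_join x y) /\
  rv_join (mix (pred1 k) t x) (mix (pred1 k) s y) = mix (pred1 k) s (rv_join x y).
Proof.
move=> ts; split; apply: eq_rV => i; rewrite !mxE /=; case: eqVneq => // ->.
  exact/max_idPl.
exact/max_idPr.
Qed.

Lemma rv_meet_mix k s t x y : (t ord0 k <= s ord0 k)%R ->
  rv_meet (mix (pred1 k) s x) (mix (pred1 k) t y) = mix (pred1 k) t (rv_meet x y) /\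
  rv_meet (mix (pred1 k) t x) (mix (pred1 k) s y) = mix (pred1 k) t (rv_meet x y).
Proof.
move=> ts; split; apply: eq_rV => i; rewrite !mxE /=; case: eqVneq => // ->.
  exact/min_idPr.
exact/min_idPl.
Qed.

Let depends_on (l : seq 'I_d) (a : V -> \bar R) :=
  forall x y, (forall i, i \in l -> x ord0 i = y ord0 i) -> a x = a y.

Let average_depends k l a : depends_on (k :: l) a -> depends_on l (average k a).
Proof.
move=> al x y xy; apply: eq_integral => s _; apply: al => i.
rewrite !mixE inE /=; case: eqVneq => //= _; exact: xy.
Qed.

(** Averaging over one coordinate preserves the integrals of the four functions,
and preserves their hypothesis by the totally ordered case. After all
coordinates have been averaged out, the functions are constant and the
hypothesis is the conclusion. *)
Lemma four_functions_rV : four_functions mu rv_join rv_meet.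
Proof.
suff ind l (a b c e : V -> \bar R) :
    measurable_fun setT a -> measurable_fun setT b ->
    measurable_fun setT c -> measurable_fun setT e ->
    (forall x, 0 <= a x) -> (forall x, 0 <= b x) ->
    (forall x, 0 <= c x) -> (forall x, 0 <= e x) ->
    depends_on l a -> depends_on l b -> depends_on l c -> depends_on l e ->
    (forall x y, a x * b y <= c (rv_join x y) * e (rv_meet x y)) ->
    (\int[mu]_x a x) * (\int[mu]_x b x) <= (\int[mu]_x c x) * (\int[mu]_x e x).
  have all a : depends_on (enum 'I_d) a.
    by move=> x y xy; congr a; apply: eq_rV => i; apply: xy; rewrite mem_enum.
  by move=> a b c e *; exact: (ind (enum 'I_d)).
elim: l a b c e => [|k l IH] a b c e ma mb mc me a0 b0 c0 e0 la lb lc le H.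
  have cst (u : V -> \bar R) : depends_on [::] u -> \int[mu]_x u x = u 0%R.
    move=> lu; under eq_integral => x _ do rewrite (lu x 0%R)//.
    by rewrite integral_cst//= probability_setT mule1.
  rewrite !cst//; have := H 0%R 0%R.
  by rewrite (lc (rv_join _ _) 0%R)// (le (rv_meet _ _) 0%R).
rewrite (@integral_average k a)// (@integral_average k b)//
  (@integral_average k c)// (@integral_average k e)//.
apply: IH.
1-4: exact: measurable_average.
1-4: by move=> x; exact: integral_ge0.
1-4: exact: average_depends.
move=> x y; apply: (@four_functions_chain _ _ _ mu (fun s => s ord0 k)).
1-4: exact: msec.
1-4: by move=> s; auto.
move=> s t ts.
have [j1 j2] := rv_join_mix x y ts; have [m1 m2] := rv_meet_mix x y ts.
by split; rewrite -?j1 -?m1 ?H// j1 m1 -j2 -m2.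
Qed.

End average.
End resampling.

(** * Covariance along one coordinate *)

Definition chord_convex {R : realType} (h : R -> R) : Prop :=
  forall a b c, a <= b -> b <= c -> (c - a) * h b <= (c - b) * h a + (b - a) * h c.

(** Both determinants have the sign of the permutation that sorts a, b, c. *)
Lemma det_chord_convex {R : realType} (h1 h2 : R -> R) :
  chord_convex h1 -> chord_convex h2 -> forall a b c,
  0 <= ((b - a) * h1 c + (a - c) * h1 b + (c - b) * h1 a) *
       ((b - a) * h2 c + (a - c) * h2 b + (c - b) * h2 a).
Proof.
move=> cvx1 cvx2.
pose D (h : R -> R) a b c := (b - a) * h c + (a - c) * h b + (c - b) * h a.
rewrite -/D; have sorted a b c : a <= b -> b <= c -> 0 <= D h1 a b c * D h2 a b c.
  move=> ab bc; have := cvx1 _ _ _ ab bc; have := cvx2 _ _ _ ab bc.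
  by move=> ? ?; apply: mulr_ge0; rewrite /D; lra.
have swap12 a b c : D h1 a b c * D h2 a b c = D h1 b a c * D h2 b a c.
  by rewrite /D; ring.
have swap23 a b c : D h1 a b c * D h2 a b c = D h1 a c b * D h2 a c b.
  by rewrite /D; ring.
move=> a b c; rewrite -/(D h1 a b c) -/(D h2 a b c).
wlog ab : a b / a <= b.
  move=> wl; case/orP: (le_total a b) => ab; first exact: wl.
  by rewrite swap12; exact: wl.
case/orP: (le_total b c) => bc; first exact: sorted.
rewrite swap23; case/orP: (le_total a c) => ac; first exact: sorted.
by rewrite swap12; exact: sorted.
Qed.

Section coordinate_step.
Context {R : realType} {d : nat}.
Local Notation V := 'rV[R]_d.
Variable mu : probability V R.
Hypothesis mu_swap : swap_invariant mu.
Variable k : 'I_d.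
Local Notation mumu := ((mu \x mu)%E : probability (V * V)%type R).

Definition upd (c : R) (x : V) : V := \row_i (if i == k then c else x ord0 i).

Lemma mix_pred1 (s x : V) : mix (pred1 k) s x = upd (s ord0 k) x.
Proof. by apply: eq_rV => i; rewrite !mxE /=; case: eqVneq => // ->. Qed.

Definition convex_along (f : V -> R) : Prop :=
  forall x, chord_convex (fun c => f (upd c x)).

Local Notation U := (mix (pred1 k)).

Lemma mixUU (s t x : V) : U t (U s x) = U t x.
Proof. by apply: eq_rV => i; rewrite !mixE /=; case: eqVneq. Qed.

Let avg (h : V -> R) x := \int[mu]_s h (U s x).

Lemma L1_resample (h : V -> R) : L1 mu h -> L1 mumu (fun z => h (U z.2 z.1)).
Proof. exact: (preserving_L1 (preserving_mixr mu_swap (pred1 k))). Qed.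

Lemma L1_avg (h : V -> R) : L1 mu h -> L1 mu (avg h).
Proof. by move=> ih; exact: (L1_Rint (L1_resample ih)). Qed.

Lemma Rint_avg (h : V -> R) : L1 mu h -> \int[mu]_x avg h x = \int[mu]_x h x.
Proof.
move=> ih; rewrite (preserving_Rint (preserving_mixr mu_swap (pred1 k)) ih).
by rewrite (Rint_prod (h := fun x s => h (U s x)) (L1_resample ih)).
Qed.

Lemma measurable_resample (h : V -> R) x : measurable_fun setT h ->
  measurable_fun setT (fun s => h (U s x)).
Proof.
move=> mh; have [mm _] := preserving_mixr mu_swap (pred1 k).
exact: (measurableT_comp (measurableT_comp mh mm) (pair1_measurable x)).
Qed.

(** The function avg b does not depend on the k-th coordinate, so a can be
replaced with avg a when it is integrated against avg b. *)
Lemma avg_mul (a b : V -> R) : measurable_fun setT a -> measurable_fun setT b ->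
  L1 mumu (fun z => a z.1 * b (U z.2 z.1)) ->
  L1 mu (fun x => avg a x * avg b x) /\
  \int[mu]_x (avg a x * avg b x) = \int[mumu]_z (a z.1 * b (U z.2 z.1)).
Proof.
move=> ma mb iab.
have aavgE x : \int[mu]_t (a x * b (U t x)) = a x * avg b x.
  by rewrite RintZ//; exact: measurable_resample.
have iaavg : L1 mu (fun x => a x * avg b x).
  have := L1_Rint (h := fun x t => a x * b (U t x)) iab.
  by under eq_fun do rewrite aavgE.
have avgE x : avg (fun y => a y * avg b y) x = avg a x * avg b x.
  rewrite mulrC -RintZ; last exact: measurable_resample.
  apply: eq_Rintegral => s _; rewrite mulrC; congr (_ * _).
  by apply: eq_Rintegral => t _; rewrite mixUU.
split; first by under eq_fun do rewrite -avgE; exact: L1_avg.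
under eq_Rintegral do rewrite -avgE.
rewrite Rint_avg// (Rint_prod (h := fun x t => a x * b (U t x)) iab).
by apply: eq_Rintegral => x _; rewrite aavgE.
Qed.

Lemma ae_L2_resample (h : V -> R) : L2 mu h ->
  {ae mu, forall x, L2 mu (fun s => h (U s x))}.
Proof.
move=> [mh ih]; have := ae_L1_section (h := fun x s => h (U s x) ^+ 2) (L1_resample ih).
apply: filterS => x ix; split=> //; exact: measurable_resample.
Qed.

Variable X : V -> R.
Hypotheses (X2 : L2 mu X) (X0 : \int[mu]_x X x = 0).
Hypothesis XE : exists m, forall x, X x = x ord0 k - m.

Lemma centered_mix (s x : V) : X (U s x) = X s.
Proof. by case: XE => m E; rewrite !E mixE /= eqxx. Qed.

Section two_functions.
Variables f g : V -> R.
Hypotheses (f2 : L2 mu f) (g2 : L2 mu g).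

Lemma L1_cross : L1 mumu (fun z => f z.1 * g (U z.2 z.1)).
Proof.
apply: L2_mul; first exact: (preserving_L2 (preserving_fst mu mu) f2).
exact: (preserving_L2 (preserving_mixr mu_swap (pred1 k)) g2).
Qed.

Lemma L2_weighted : L2 mumu (fun z => X z.1 * g (U z.2 z.1)).
Proof.
apply: eq_L2 (preserving_L2 (mu_swap (pred1 k)) (L2_prod g2 X2)) => z /=.
by rewrite centered_mix mulrC.
Qed.

Lemma L1_weighted_cross1 : L1 mumu (fun z => f z.1 * X z.1 * g (U z.2 z.1)).
Proof.
apply: eq_L1 (L2_mul (preserving_L2 (preserving_fst mu mu) f2) L2_weighted) => z /=.
by rewrite mulrA.
Qed.

Lemma L1_weighted_cross :
  L1 mumu (fun z => f z.1 * X z.1 * (X z.2 * g (U z.2 z.1))).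
Proof.
by apply: eq_L1 (L2_mul (L2_prod f2 X2) L2_weighted) => z; rewrite /= mulrACA.
Qed.

(** For almost every x, covariance_regression applies to f and g as functions of
the k-th coordinate, the others being those of x; the bound is then integrated
over x. *)
Lemma coordinate_covariance_ge : convex_along f -> convex_along g ->
  \int[mumu]_z (f z.1 * X z.1 * (X z.2 * g (U z.2 z.1))) <=
  \int[mu]_x (X x ^+ 2) *
    (\int[mu]_x (f x * g x) - \int[mumu]_z (f z.1 * g (U z.2 z.1))).
Proof.
move=> cvxf cvxg.
have [mf mg mX] : [/\ measurable_fun setT f, measurable_fun setT g &
    measurable_fun setT X] by case: f2; case: g2; case: X2.
have [i1 e1] := avg_mul mf mg L1_cross.
have wE (z : V * V) : f z.1 * X z.1 * (X z.2 * g (U z.2 z.1)) =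
    f z.1 * X z.1 * (X (U z.2 z.1) * g (U z.2 z.1)) by rewrite centered_mix.
have i2' : L1 mumu (fun z => f z.1 * X z.1 * (X (U z.2 z.1) * g (U z.2 z.1))).
  exact: eq_L1 wE L1_weighted_cross.
have [i2 e2] := avg_mul (a := fun x => f x * X x) (b := fun x => X x * g x)
  (measurable_funM mf mX) (measurable_funM mX mg) i2'.
under eq_Rintegral do rewrite wE.
rewrite -e1 -e2 -(Rint_avg (L2_mul f2 g2)).
have iavg := L1_avg (L2_mul f2 g2).
rewrite -RintB// -RintZ//; last by apply: L1_measurable; exact: L1B iavg i1.
apply: ae_le_Rint => //; first by apply: L1Z; exact: L1B iavg i1.
have := ae_L2_resample f2; have := ae_L2_resample g2.
apply: filterS2 => x g2x f2x.
have := covariance_regression X2 f2x g2x X0.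
have -> : \int[mu]_s (f (U s x) * X s) = avg (fun y => f y * X y) x.
  by apply: eq_Rintegral => s _; rewrite centered_mix.
have -> : \int[mu]_s (g (U s x) * X s) = avg (fun y => X y * g y) x.
  by apply: eq_Rintegral => s _; rewrite centered_mix mulrC.
apply => s t u; have [m E] := XE.
have := det_chord_convex (cvxf x) (cvxg x) (s ord0 k) (t ord0 k) (u ord0 k).
move=> det_ge0; apply: (le_trans det_ge0); rewrite /det3 !E !mix_pred1.
by rewrite le_eqVlt; apply/orP; left; apply/eqP; ring.
Qed.

End two_functions.
End coordinate_step.

(** * Replacing the coordinates one at a time *)

Lemma ae_eq0_of_sqr {disp} {T : measurableType disp} {R : realType}
    (P : probability T R) (a : T -> R) : L2 P a -> \int[P]_x (a x ^+ 2) = 0 ->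
  {ae P, forall x, a x = 0}.
Proof.
move=> [ma ia] a0.
have : (\int[P]_x `|(a x ^+ 2)%:E| = 0)%E.
  under eq_integral do rewrite gee0_abs ?lee_fin ?sqr_ge0//.
  by rewrite -L1_fineK// a0.
move/(ae_eq_integral_abs P measurableT (measurable_int _ ia)).
by apply: filterS => x /(_ I) [] /eqP; rewrite sqrf_eq0 => /eqP.
Qed.

Section telescoping.
Context {R : realType} {d : nat}.
Local Notation V := 'rV[R]_d.
Variable mu : probability V R.
Hypothesis mu_swap : swap_invariant mu.
Hypothesis coord2 : forall k, L2 mu (fun x : V => x ord0 k).
Local Notation mumu := ((mu \x mu)%E : probability (V * V)%type R).
Variables f g : V -> R.
Hypotheses (f2 : L2 mu f) (g2 : L2 mu g).

(** The mean of f (x) g (y) where y has the coordinates of x off S and those of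
an independent copy of x on S. It interpolates between the integral of f g and
the product of the integrals. *)
Definition mixed_mean (S : pred 'I_d) : R :=
  \int[mumu]_z (f z.1 * g (mix S z.2 z.1)).

Lemma L2_g_mix S : L2 mumu (fun z => g (mix S z.2 z.1)).
Proof. exact: (preserving_L2 (preserving_mixr mu_swap S) g2). Qed.

Lemma L2_f_fst : L2 mumu (fun z => f z.1).
Proof. exact: (preserving_L2 (preserving_fst mu mu) f2). Qed.

Lemma L1_mixed_mean S : L1 mumu (fun z => f z.1 * g (mix S z.2 z.1)).
Proof. exact: L2_mul L2_f_fst (L2_g_mix S). Qed.

Section step.
Variables (k : 'I_d) (S S' : pred 'I_d).
Hypotheses (Sk : ~~ S k) (S'E : forall i, S' i = (i == k) || S i).
Local Notation U := (mix (pred1 k)).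

(** Resampling the k-th coordinate of x or of w amounts to the same, because
mix S' reads this coordinate from w. *)
Lemma mix_resample (w t x : V) : mix S w (U t x) = mix S' (U t w) x.
Proof.
apply: eq_rV => i; rewrite !mixE /= S'E; case: eqVneq => [->|_] //=.
by rewrite (negbTE Sk).
Qed.

Lemma mix_upd (w x : V) c : mix S w (upd k c x) = upd k c (mix S w x).
Proof.
apply: eq_rV => i; rewrite !mxE; case: eqVneq => [->|_] //.
by rewrite (negbTE Sk).
Qed.

Let m := \int[mu]_x (x ord0 k).

Definition centered_coord (x : V) : R := x ord0 k - \int[mu]_y (y ord0 k).

Local Notation X := centered_coord.

Lemma L2_centered : L2 mu X.
Proof. by apply: L2D => //; exact: L2_cst. Qed.

Lemma Rint_centered : \int[mu]_x X x = 0.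
Proof.
by rewrite RintB ?Rint_cst ?subrr//; [exact: L2_L1|exact: L1_cst].
Qed.

Let XE : exists c, forall x, X x = x ord0 k - c.
Proof. by exists m. Qed.

(** The lower bound that the regression on the k-th coordinate yields for the
effect of replacing this coordinate by an independent copy. *)
Definition cross_moment : R :=
  \int[mumu]_z (f z.1 * X z.1 * (X z.2 * g (mix S' z.2 z.1))).

Let S'k : S' k. Proof. by rewrite S'E eqxx. Qed.

Lemma L2_X_g_mix : L2 mumu (fun z => X z.1 * g (mix S' z.2 z.1)).
Proof.
apply: eq_L2 (preserving_L2 (mu_swap S') (L2_prod g2 L2_centered)) => z /=.
by rewrite /X mixE S'k mulrC.
Qed.

Lemma L1_cross_mix :
  L1 mumu (fun z => f z.1 * X z.1 * (X z.2 * g (mix S' z.2 z.1))).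
Proof.
apply: eq_L1 (L2_mul (L2_prod f2 L2_centered) L2_X_g_mix) => z /=.
by rewrite mulrACA.
Qed.

Let g_ w x := g (mix S w x).
Let h w := \int[mu]_x (f x * g (mix S' w x)).
Let h2 w := \int[mu]_x (f x * X x * (X w * g (mix S' w x))).

Let ih : L1 mu h.
Proof.
exact: (L1_Rint (h := fun w x => f x * g (mix S' w x))
  (L1_twist (h := fun x w => f x * g (mix S' w x)) (L1_mixed_mean S'))).
Qed.

Let ih2 : L1 mu h2.
Proof.
exact: (L1_Rint (h := fun w x => f x * X x * (X w * g (mix S' w x)))
  (L1_twist (h := fun x w => f x * X x * (X w * g (mix S' w x))) L1_cross_mix)).
Qed.

Let Rint_h : \int[mu]_w h w = mixed_mean S'.
Proof.
by rewrite /mixed_mean (Rint_prod2 (h := fun x w => f x * g (mix S' w x)))//;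
  exact: L1_mixed_mean.
Qed.

Let Rint_h2 : \int[mu]_w h2 w = cross_moment.
Proof.
by rewrite /cross_moment (Rint_prod2 (h := fun x w => f x * X x * (X w * g (mix S' w x))))//;
  exact: L1_cross_mix.
Qed.

Lemma ae_L2_section : {ae mu, forall w, L2 mu (g_ w)}.
Proof.
have [mg ig] := L2_g_mix S.
have := ae_L1_section2 (h := fun x w => g (mix S w x) ^+ 2) ig.
apply: filterS => w iw; split=> //.
exact: (measurableT_comp mg (pair2_measurable w)).
Qed.

Let Rint_avg_h w : L2 mu (g_ w) ->
  \int[mumu]_z (f z.1 * g_ w (U z.2 z.1)) = \int[mu]_t h (U t w).
Proof.
move=> gw2.
rewrite (Rint_prod2 (h := fun x t => f x * g_ w (U t x))); last first.
  exact: (L1_cross mu_swap k f2 gw2).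
apply: eq_Rintegral => t _; apply: eq_Rintegral => x _.
by rewrite /g_ mix_resample.
Qed.

Let Rint_avg_h2 w : L2 mu (g_ w) ->
  \int[mumu]_z (f z.1 * X z.1 * (X z.2 * g_ w (U z.2 z.1))) =
  \int[mu]_t h2 (U t w).
Proof.
move=> gw2.
rewrite (Rint_prod2 (h := fun x t => f x * X x * (X t * g_ w (U t x)))); last first.
  exact: (L1_weighted_cross mu_swap L2_centered XE f2 gw2).
apply: eq_Rintegral => t _; apply: eq_Rintegral => x _.
by rewrite /g_ mix_resample (centered_mix XE).
Qed.

(** The cross moment is the mean over w of the right-hand integrals, so its sign
can be studied with the coordinates in S frozen. *)
Lemma cross_ge0_of_sections :
  {ae mu, forall w, L2 mu (g_ w) ->
    0 <= \int[mumu]_z (f z.1 * X z.1 * (X z.2 * g_ w (U z.2 z.1)))} ->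
  0 <= cross_moment.
Proof.
move=> H; rewrite -Rint_h2 -(Rint_avg mu_swap k ih2) -[leLHS](Rint_cst mu).
apply: ae_le_Rint; [exact: L1_cst|exact: L1_avg|].
move: ae_L2_section H; apply: filterS2 => w gw2 /(_ gw2).
by rewrite Rint_avg_h2.
Qed.

Hypotheses (cvxf : convex_along k f) (cvxg : convex_along k g).

(** This is coordinate_covariance_ge for f and the section of g at w, for almost
every w, integrated over w. *)
Lemma cross_le : cross_moment <= \int[mu]_x (X x ^+ 2) * (mixed_mean S - mixed_mean S').
Proof.
have ifg := L1_mixed_mean S.
rewrite [mixed_mean S](Rint_prod2 (h := fun x w => f x * g (mix S w x)))//.
rewrite -Rint_h -Rint_h2 -(Rint_avg mu_swap k ih) -(Rint_avg mu_swap k ih2).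
have iS : L1 mu (fun w => \int[mu]_x (f x * g_ w x)).
  exact: (L1_Rint (h := fun w x => f x * g (mix S w x))
    (L1_twist (h := fun x w => f x * g (mix S w x)) ifg)).
have iavg := L1_avg mu_swap k ih; have iavg2 := L1_avg mu_swap k ih2.
rewrite -RintB// -RintZ; last by apply: L1_measurable; exact: L1B iS iavg.
apply: ae_le_Rint => //; first by apply: L1Z; exact: L1B iS iavg.
apply: filterS ae_L2_section => w gw2.
rewrite -Rint_avg_h// -Rint_avg_h2//.
apply: (coordinate_covariance_ge mu_swap L2_centered Rint_centered XE f2 gw2) => //.
move=> x a b c ab bc; rewrite /g_ !mix_upd; exact: cvxg.
Qed.

Lemma mixed_mean_le : 0 <= cross_moment -> mixed_mean S' <= mixed_mean S.
Proof.
move=> cross0; have := le_trans cross0 cross_le.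
have V0 : 0 <= \int[mu]_x (X x ^+ 2) by apply: Rintegral_ge0 => x _; exact: sqr_ge0.
have [V_eq0 _|V_neq0] := eqVneq (\int[mu]_x (X x ^+ 2)) 0; last first.
  by rewrite pmulr_rge0 ?subr_ge0// lt_def V_neq0.
(* The k-th coordinate is almost surely constant: replacing it has no effect. *)
have X1 : {ae mumu, forall z, X z.1 = 0}.
  apply: ae_eq0_of_sqr (preserving_L2 (preserving_fst mu mu) L2_centered) _.
  by rewrite -(preserving_Rint (preserving_fst mu mu) (h := fun x => X x ^+ 2))//;
    case: L2_centered.
have X2 : {ae mumu, forall z, X z.2 = 0}.
  apply: ae_eq0_of_sqr (preserving_L2 (preserving_snd mu mu) L2_centered) _.
  by rewrite -(preserving_Rint (preserving_snd mu mu) (h := fun x => X x ^+ 2))//;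
    case: L2_centered.
rewrite le_eqVlt; apply/orP; left; apply/eqP.
apply: ae_eq_Rint; do ?exact: L1_mixed_mean.
apply: filterS2 X1 X2 => z z1 z2; congr (_ * g _); apply: eq_rV => i.
rewrite !mixE S'E; case: eqVneq => [->|_]//=; rewrite (negbTE Sk).
by apply: (addIr (- m)); rewrite -/(X z.1) -/(X z.2) z1.
Qed.

End step.

(** The coordinates are replaced in increasing order; no replacement increases
the mean of f (x) g (y), by mixed_mean_le. *)
Lemma correlation_of_cross_ge0 :
  (forall k, convex_along k f) -> (forall k, convex_along k g) ->
  (forall k : 'I_d, 0 <= cross_moment k (fun i => (i <= k)%N)) ->
  \int[mu]_x f x * \int[mu]_x g x <= \int[mu]_x (f x * g x).
Proof.
move=> cvxf cvxg cross0.
have start : mixed_mean (fun i : 'I_d => (i < 0)%N) = \int[mu]_x (f x * g x).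
  rewrite (preserving_Rint (preserving_fst mu mu) (L2_mul f2 g2)).
  by apply: eq_Rintegral => z _; rewrite mix0.
have stop : mixed_mean (fun i : 'I_d => (i < d)%N) = \int[mu]_x f x * \int[mu]_x g x.
  transitivity (\int[mumu]_z (f z.1 * g z.2)).
    by apply: eq_Rintegral => z _; rewrite mixT.
  rewrite (Rint_prod (h := fun x w => f x * g w)); last first.
    by apply: L1_prod; exact: L2_L1.
  rewrite mulrC -RintZ; last by case: f2.
  apply: eq_Rintegral => x _; rewrite RintZ; last by case: g2.
  by rewrite mulrC.
rewrite -start -stop.
suff mono n : (n <= d)%N ->
    mixed_mean (fun i : 'I_d => (i < n)%N) <= mixed_mean (fun i : 'I_d => (i < 0)%N).
  exact: mono.
elim: n => [//|n IH] nd; apply: le_trans (IH (ltnW nd)).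
apply: (@mixed_mean_le (Ordinal nd)) => //=; first by rewrite -leqNgt.
by move=> i; rewrite ltnS leq_eqVlt.
Qed.

End telescoping.

(** * Nonnegativity of the cross moments *)

Section cross_nonneg.
Context {R : realType} {d : nat}.
Local Notation V := 'rV[R]_d.
Variable mu : probability V R.
Hypothesis mu_swap : swap_invariant mu.
Hypothesis coord2 : forall k, L2 mu (fun x : V => x ord0 k).
Local Notation mumu := ((mu \x mu)%E : probability (V * V)%type R).
Variable f : V -> R.
Hypothesis f2 : L2 mu f.
Hypothesis f0 : forall x, 0 < f x.
Hypothesis lsmf : log_supermodular rv_join rv_meet f.

Definition supermodular_along (k : 'I_d) (h : V -> R) : Prop :=
  forall a b, a <= b -> increasing_for rv_join (fun x => h (upd k b x) - h (upd k a x)).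

Lemma increasing_centered (k : 'I_d) : increasing_for rv_join (centered_coord mu k).
Proof.
by move=> x y; rewrite /centered_coord !lerD2r !mxE !le_max !lexx orbT.
Qed.

Section orthogonal.
Variable k : 'I_d.
Local Notation U := (mix (pred1 k)).
Local Notation X := (centered_coord mu k).
Hypothesis fX0 : \int[mu]_x (f x * X x) = 0.

(** As a function of the resampled vector t, the mean K t of f X g (U t x) is
nondecreasing in the k-th coordinate of t: the increments of g along this
coordinate are increasing functions, so by the FKG inequality with weight f
their mean against the centered and increasing X is nonnegative. The integral
is that of X K, which chebyshev_association bounds below by 0. *)
Lemma cross_section_ge0 (g : V -> R) : L2 mu g -> supermodular_along k g ->
  0 <= \int[mumu]_z (f z.1 * X z.1 * (X z.2 * g (U z.2 z.1))).
Proof.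
move=> g2 smg.
have X2 : L2 mu X := L2_centered coord2 k.
have XE : exists c, forall x, X x = x ord0 k - c by eexists.
have iw := L1_weighted_cross mu_swap X2 XE f2 g2.
have iw1 := L1_weighted_cross1 mu_swap X2 XE f2 g2.
have ic := L1_cross mu_swap k f2 g2.
have [mf mg mX] : [/\ measurable_fun setT f, measurable_fun setT g &
    measurable_fun setT X] by case: f2; case: g2; case: X2.
rewrite (Rint_prod2 (h := fun x t => f x * X x * (X t * g (U t x))))//.
pose K t := \int[mu]_x (f x * X x * g (U t x)).
have mgU t : measurable_fun setT (fun x => g (U t x)).
  have [mm _] := preserving_mixr mu_swap (pred1 k).
  exact: (measurableT_comp (measurableT_comp mg mm) (pair2_measurable t)).
have XK t : \int[mu]_x (f x * X x * (X t * g (U t x))) = X t * K t.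
  rewrite -RintZ; first by apply: eq_Rintegral => x _; ring.
  by apply: measurable_funM => //; exact: measurable_funM.
under eq_Rintegral do rewrite XK.
pose good := [set t | L1 mu (fun x => f x * X x * g (U t x)) /\
                      L1 mu (fun x => f x * g (U t x))].
apply: (chebyshev_association (good := good)).
- exact: L2_L1 X2.
- exact: (L1_Rint (h := fun t x => f x * X x * g (U t x))
    (L1_twist (h := fun x t => f x * X x * g (U t x)) iw1)).
- apply: eq_L1 XK _.
  exact: (L1_Rint (h := fun t x => f x * X x * (X t * g (U t x)))
    (L1_twist (h := fun x t => f x * X x * (X t * g (U t x))) iw)).
- exact: Rint_centered coord2 k.
- apply: filterS2 (ae_L1_section2 (h := fun x t => f x * X x * g (U t x)) iw1)
    (ae_L1_section2 (h := fun x t => f x * g (U t x)) ic).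
  by move=> t ? ?; split.
suff mono s t : good s -> good t -> s ord0 k <= t ord0 k -> K s <= K t.
  move=> s t gs gt; case/orP: (le_total (s ord0 k) (t ord0 k)) => st.
    by apply: mulr_le0; rewrite subr_le0 ?mono// /centered_coord lerD2r.
  by apply: mulr_ge0; rewrite subr_ge0 ?mono// /centered_coord lerD2r.
move=> [s1 s2] [t1 t2] st; rewrite -subr_ge0 -RintB//.
pose D x := g (U t x) - g (U s x).
have fXD x : f x * (X x * D x) = f x * X x * g (U t x) - f x * X x * g (U s x).
  by rewrite /D; ring.
have fD x : f x * D x = f x * g (U t x) - f x * g (U s x) by rewrite /D; ring.
have iD : L1 mu (fun x => f x * D x) by under eq_fun do rewrite fD; exact: L1B.
have iXD : L1 mu (fun x => f x * (X x * D x)).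
  by under eq_fun do rewrite fXD; exact: L1B.
have mD : measurable_fun setT D by apply: measurable_funB.
have incD : increasing_for rv_join D.
  by move=> x y; have := smg _ _ st x y; rewrite /D !mix_pred1.
have := fkg (four_functions_rV mu_swap) (fun x => ltW (f0 x)) (L2_L1 f2) lsmf
  mX mD (increasing_centered k) incD (L2_mul f2 X2) iD iXD.
rewrite fX0 mul0r pmulr_rge0; last exact: Rint_gt0 (L2_L1 f2) f0.
by under eq_Rintegral do rewrite fXD.
Qed.

Lemma cross_ge0_orthogonal (g : V -> R) (S S' : pred 'I_d) : ~~ S k ->
  (forall i, S' i = (i == k) || S i) -> L2 mu g -> supermodular_along k g ->
  0 <= cross_moment mu f g k S'.
Proof.
move=> Sk S'E g2 smg.
apply: (cross_ge0_of_sections mu_swap coord2 f2 g2 Sk S'E).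
apply: aeW => w gw2; apply: (cross_section_ge0 (g := fun x => g (mix S w x))) => //.
move=> a b ab x y.
have := smg _ _ ab (mix S w x) (mix S w y).
have -> : rv_join (mix S w x) (mix S w y) = mix S w (rv_join x y).
  by apply: eq_rV => i; rewrite !mxE; case: (S i) => //; exact: maxxx.
by rewrite -!(mix_upd Sk).
Qed.

End orthogonal.

Section even.
Variable g : V -> R.
Hypotheses (g2 : L2 mu g) (g0 : forall x, 0 < g x).
Hypothesis lsmg : log_supermodular rv_join rv_meet g.
Hypothesis mu_opp : preserving mu mu (fun x : V => - x).
Hypotheses (f_even : even_fun f) (g_even : even_fun g).

Lemma preserving_opp_prod : preserving mumu mumu (fun z : V * V => (- z.1, - z.2)).
Proof.
have [mopp opp_mu] := mu_opp.
apply: preserving_to_prod.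
  by apply/measurable_fun_pairP; split; [exact: (measurableT_comp mopp measurable_fst)
    |exact: (measurableT_comp mopp measurable_snd)].
move=> A B mA mB.
rewrite -(opp_mu _ mA) -(opp_mu _ mB) -product_measure1E//.
- by rewrite -[X in measurable X]setTI; exact: mopp.
- by rewrite -[X in measurable X]setTI; exact: mopp.
Qed.

Lemma Rint_odd {disp} {T : measurableType disp} (P : probability T R)
    (tau : T -> T) (h : T -> R) : preserving P P tau -> L1 P h ->
  (forall x, h (tau x) = - h x) -> \int[P]_x h x = 0.
Proof.
move=> ptau ih hodd; have := preserving_Rint ptau ih.
under [X in _ = X -> _]eq_Rintegral do rewrite hodd -mulN1r.
by rewrite RintZ; [lra|exact: L1_measurable ih].
Qed.

Lemma Rint_coord_symmetric k : \int[mu]_x (x ord0 k) = 0.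
Proof.
apply: (Rint_odd mu_opp); first exact: L2_L1.
by move=> x; rewrite mxE.
Qed.

(** The weight F (x, w) = f (x) g (y), where y is w on S' and x off S', is
log-supermodular on pairs. The cross moment is the F-mean of the product of the
k-th coordinates of x and w; by the FKG inequality it is at least the product
of their F-means, which vanish because F is even. *)
Lemma cross_ge0_even k (S' : pred 'I_d) : S' k -> 0 <= cross_moment mu f g k S'.
Proof.
move=> S'k; rewrite /cross_moment; set X := centered_coord mu k.
have XE x : X x = x ord0 k by rewrite /X /centered_coord Rint_coord_symmetric subr0.
have X2 : L2 mu X := L2_centered coord2 k.
have mX : measurable_fun setT X by case: X2.
pose F (z : V * V) := f z.1 * g (mix S' z.2 z.1).
have iF : L1 mumu F := L1_mixed_mean mu_swap f2 g2 S'.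
have F0 z : 0 < F z by apply: mulr_gt0.
have Xg2 : L2 mumu (fun z => X z.1 * g (mix S' z.2 z.1)).
  apply: eq_L2 (preserving_L2 (mu_swap S') (L2_prod g2 X2)) => z /=.
  by rewrite !XE mixE S'k mulrC.
have iFX1 : L1 mumu (fun z => F z * X z.1).
  apply: eq_L1 (L2_mul (L2_f_fst f2) Xg2) => z /=.
  by rewrite /F; ring.
have iFX2 : L1 mumu (fun z => F z * X z.2).
  apply: eq_L1 (L2_mul (L2_prod f2 X2) (L2_g_mix mu_swap g2 S')) => z /=.
  by rewrite /F; ring.
have iFXX : L1 mumu (fun z => F z * (X z.1 * X z.2)).
  by apply: eq_L1 (L2_mul (L2_prod f2 X2) Xg2) => z /=; rewrite /F; ring.
have lsmF : log_supermodular
    (fun x y : V * V => (rv_join x.1 y.1, rv_join x.2 y.2))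
    (fun x y : V * V => (rv_meet x.1 y.1, rv_meet x.2 y.2)) F.
  move=> [x w] [y v]; rewrite /F /=.
  have -> : mix S' (rv_join w v) (rv_join x y) = rv_join (mix S' w x) (mix S' v y).
    by apply: eq_rV => i; rewrite !mxE; case: (S' i).
  have -> : mix S' (rv_meet w v) (rv_meet x y) = rv_meet (mix S' w x) (mix S' v y).
    by apply: eq_rV => i; rewrite !mxE; case: (S' i).
  rewrite mulrACA [leRHS]mulrACA.
  by apply: ler_pM => //; apply: mulr_ge0; exact: ltW.
have := fkg (four_functions_prod (four_functions_rV mu_swap) (four_functions_rV mu_swap))
  (fun z => ltW (F0 z)) iF lsmF (h1 := fun z => X z.1) (h2 := fun z => X z.2)
  (measurableT_comp mX measurable_fst) (measurableT_comp mX measurable_snd)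
  (fun x y => increasing_centered k x.1 y.1) (fun x y => increasing_centered k x.2 y.2)
  iFX1 iFX2 iFXX.
rewrite (Rint_odd preserving_opp_prod iFX1); last first.
  move=> z /=; rewrite /F /= !XE mxE mulrN f_even; congr (- (_ * _ * _)).
  by rewrite -[RHS]g_even; congr g; apply: eq_rV => i; rewrite !mxE; case: (S' i).
rewrite mul0r pmulr_rge0; last exact: Rint_gt0.
have FXX z : F z * (X z.1 * X z.2) = f z.1 * X z.1 * (X z.2 * g (mix S' z.2 z.1)).
  by rewrite /F; ring.
by under eq_Rintegral do rewrite FXX.
Qed.

End even.
End cross_nonneg.

(** * Convexity and supermodularity from second derivatives *)

Section calculus.
Context {R : realType}.

Lemma nondecreasing_of_derive_ge0 (h dh : R -> R) :
  (forall c : R, is_derive c (1 : R) h (dh c)) -> (forall c, 0 <= dh c) ->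
  forall a b, a <= b -> h a <= h b.
Proof.
move=> hdh dh0 a b ab.
have [c _ E] := MVT_segment ab (fun x _ => hdh x)
  (derivable_within_continuous (fun x _ => @ex_derive _ _ _ _ _ _ _ (hdh x))).
by rewrite -subr_ge0 E mulr_ge0// subr_ge0.
Qed.

Lemma chord_convex_of_derive_nondecreasing (h dh : R -> R) :
  (forall c : R, is_derive c (1 : R) h (dh c)) ->
  (forall a b, a <= b -> dh a <= dh b) -> chord_convex h.
Proof.
move=> hdh dh_mono a b c ab bc.
have mvt u v (uv : u <= v) : exists2 s, u <= s <= v & h v - h u = dh s * (v - u).
  have [s] := MVT_segment uv (fun x _ => hdh x)
    (derivable_within_continuous (fun x _ => @ex_derive _ _ _ _ _ _ _ (hdh x))).
  by rewrite in_itv/= => ? ?; exists s.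
have [s /andP[_ sb] E1] := mvt _ _ ab.
have [t /andP[bt _] E2] := mvt _ _ bc.
have st := dh_mono _ _ (le_trans sb bt).
have : 0 <= (dh t - dh s) * ((c - b) * (b - a)).
  by apply: mulr_ge0; [|apply: mulr_ge0]; rewrite subr_ge0.
have -> : (dh t - dh s) * ((c - b) * (b - a)) =
  (b - a) * (h c - h b) - (c - b) * (h b - h a) by rewrite E1 E2; ring.
lra.
Qed.

Context {d : nat}.
Local Notation V := 'rV[R]_d.
Implicit Types (f g h : V -> R) (x y : V) (j k : 'I_d).

Lemma updE k (c : R) x : upd k c x = c *: delta_mx ord0 k + upd k 0 x.
Proof.
apply: eq_rV => i; rewrite !mxE /=; case: eqVneq => _ /=.
  by rewrite mulr1 addr0.
by rewrite mulr0 add0r.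
Qed.

(** Directional derivatives are derivatives of functions of one variable, which
makes the one-variable chain rule available. *)
Lemma is_derive_line h x (v : V) (dh : R) :
  is_derive (0 : R) (1 : R) (fun t => h (t *: v + x)) dh <-> is_derive x v h dh.
Proof.
have E : (fun t : R => t^-1 *: (((fun t => h (t *: v + x)) \o shift 0) (t *: (1 : R)) -
    h (0 *: v + x))) =
  (fun t : R => t^-1 *: ((h \o shift x) (t *: v) - h x)).
  apply/funext => t /=; rewrite addr0 scale0r add0r; congr (_ *: (h (_ *: _ + _) - _)).
  by rewrite /GRing.scale/= mulr1.
split=> -[]; rewrite /derivable /derive/=.
  by rewrite E => *; split.
by rewrite -E => *; split.
Qed.

Lemma is_derive_upd h k x (c : R) : derivable h (upd k c x) (delta_mx ord0 k) ->
  is_derive c (1 : R) (fun t => h (upd k t x)) (partial k h (upd k c x)).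
Proof.
move=> dh.
have E : (fun t : R => t^-1 *: (((fun t => h (upd k t x)) \o shift c) (t *: (1 : R)) -
    h (upd k c x))) =
  (fun t : R => t^-1 *: ((h \o shift (upd k c x)) (t *: delta_mx ord0 k) -
    h (upd k c x))).
  apply/funext => t /=; congr (_ *: (h _ - _)).
  rewrite [LHS]updE [in RHS]updE addrA -scalerDl; congr (_ *: _ + _).
  by rewrite /GRing.scale/= mulr1.
by split; rewrite /derivable /partial /derive/= E.
Qed.

Lemma updC j k (a b : R) x : j != k -> upd k b (upd j a x) = upd j a (upd k b x).
Proof.
move=> jk; apply: eq_rV => i; rewrite !mxE.
by case: (eqVneq i k) => // ->; rewrite eq_sym (negbTE jk).
Qed.

Lemma upd_upd k (a b : R) x : upd k b (upd k a x) = upd k b x.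
Proof. by apply: eq_rV => i; rewrite !mxE; case: eqVneq. Qed.

Lemma mix_ltS (n : nat) (nd : (n < d)%N) x y :
  mix (fun i => (i < n.+1)%N) x y =
  upd (Ordinal nd) (x ord0 (Ordinal nd)) (mix (fun i => (i < n)%N) x y).
Proof.
apply: eq_rV => i; rewrite !mxE ltnS leq_eqVlt.
rewrite (_ : (i == n :> nat) = (i == Ordinal nd))//.
by case: eqVneq => [->|].
Qed.

Lemma mix_lt_upd (n : nat) (nd : (n < d)%N) x y :
  mix (fun i => (i < n)%N) x y =
  upd (Ordinal nd) (y ord0 (Ordinal nd)) (mix (fun i => (i < n)%N) x y).
Proof.
by apply: eq_rV => i; rewrite !mxE; case: eqVneq => [->|//]; rewrite /= ltnn.
Qed.

Lemma nondecreasing_of_coordinates h :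
  (forall k x (a b : R), a <= b -> h (upd k a x) <= h (upd k b x)) ->
  forall x y, (forall i, x ord0 i <= y ord0 i) -> h x <= h y.
Proof.
move=> hk x y xy.
rewrite -[x in leLHS](@mix0 _ _ (fun i => (i < 0)%N) y x)//.
rewrite -[y in leRHS](@mixT _ _ (fun i : 'I_d => (i < d)%N) y x)//.
suff mono n : (n <= d)%N -> h (mix (fun i : 'I_d => (i < 0)%N) y x) <=
    h (mix (fun i : 'I_d => (i < n)%N) y x) by exact: mono.
elim: n => [//|n IH] nd; apply: le_trans (IH (ltnW nd)) _.
by rewrite (mix_ltS nd) [X in h X <= _](mix_lt_upd nd); exact: hk.
Qed.

Lemma partial_nondecreasing h k : (forall x, derivable h x (delta_mx ord0 k)) ->
  (forall x, 0 <= partial k h x) ->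
  forall x (a b : R), a <= b -> h (upd k a x) <= h (upd k b x).
Proof.
move=> dh dh0 x a b.
apply: (@nondecreasing_of_derive_ge0 (fun t => h (upd k t x))) => c.
  exact: is_derive_upd.
exact: dh0.
Qed.

Lemma convex_along_of_partial2 h k : twice_partially_derivable h ->
  (forall x, 0 <= partial2 k k h x) -> convex_along k h.
Proof.
move=> [dh ddh] h0 x.
apply: (@chord_convex_of_derive_nondecreasing _ (fun t => partial k h (upd k t x))).
  by move=> c; exact: is_derive_upd.
by move=> a b; exact: (partial_nondecreasing (ddh k k) h0).
Qed.

(** For j different from k, the j-th derivative of an increment of h along k is
an increment along k of the j-th derivative of h, and thus nonnegative because
the mixed derivative is. *)
Lemma supermodular_along_of_partial2 h k : twice_partially_derivable h ->
  (forall i j x, 0 <= partial2 i j h x) -> supermodular_along k h.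
Proof.
move=> [dh ddh] h0 a b ab.
pose D x := h (upd k b x) - h (upd k a x).
suff mono x y : (forall i, x ord0 i <= y ord0 i) -> D x <= D y.
  by move=> x y; split; apply: mono => i; rewrite mxE le_max lexx ?orbT.
apply: nondecreasing_of_coordinates => {x y} j x s t st.
have [->|jk] := eqVneq j k; first by rewrite /D !upd_upd.
apply: (@nondecreasing_of_derive_ge0 (fun c => D (upd j c x))
  (fun c => partial j h (upd j c (upd k b x)) - partial j h (upd j c (upd k a x)))) => //.
- move=> c; rewrite /D; under eq_fun do rewrite !(updC _ _ _ jk).
  by apply: is_deriveB; exact: is_derive_upd.
- move=> c; rewrite subr_ge0 -!(updC _ _ _ jk).
  exact: (partial_nondecreasing (ddh k j) (h0 k j)).
Qed.

(** Go from the meet to x, and in parallel from y to the join, by changing one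
coordinate at a time. Each step of the second path either makes the same change
as the first one, from a larger point, or neither of them moves. *)
Lemma log_supermodular_expR h : (forall k, supermodular_along k h) ->
  log_supermodular rv_join rv_meet (fun x => expR (h x)).
Proof.
move=> smh x y; rewrite -!expRD ler_expR.
pose p n := mix (fun i : 'I_d => (i < n)%N) x (rv_meet x y).
pose q n := mix (fun i : 'I_d => (i < n)%N) (rv_join x y) y.
have pq n i : p n ord0 i <= q n ord0 i.
  by rewrite !mxE; case: ifP => _; rewrite ?le_max ?ge_min ?lexx ?orbT.
have join_pq n : rv_join (p n) (q n) = q n.
  by apply: eq_rV => i; rewrite [LHS]mxE; apply/max_idPr; exact: pq.
suff mono n : (n <= d)%N -> h (p n) - h (p 0%N) <= h (q n) - h (q 0%N).
  have := mono d (leqnn d).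
  rewrite /p /q !(@mixT _ _ (fun i : 'I_d => (i < d)%N))//.
  by rewrite !(@mix0 _ _ (fun i : 'I_d => (i < 0)%N))//; lra.
elim: n => [|n IH] nd; first by rewrite !subrr.
have := IH (ltnW nd).
suff : h (p n.+1) - h (p n) <= h (q n.+1) - h (q n) by lra.
pose k := Ordinal nd.
rewrite /p /q !(mix_ltS nd) -/k -/(p n) -/(q n).
have pk : p n = upd k (Num.min (x ord0 k) (y ord0 k)) (p n).
  by rewrite [LHS](mix_lt_upd nd) mxE.
have qk : q n = upd k (y ord0 k) (q n) by rewrite [LHS](mix_lt_upd nd).
rewrite [in h (p n)]pk [in h (q n)]qk !mxE.
have [xy|/ltW yx] := leP (x ord0 k) (y ord0 k); first by rewrite !subrr.
by have [+ _] := smh k _ _ yx (p n) (q n); rewrite join_pq.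
Qed.

(** The exponential lies above its tangent at the value of h at the middle
point, and the chord inequality for h bounds this tangent. *)
Lemma convex_along_expR h k : convex_along k h ->
  convex_along k (fun x => expR (h x)).
Proof.
move=> cvxh x a b c ab bc; have := cvxh x _ _ _ ab bc.
set B := h (upd k b x); set A := h (upd k a x); set C := h (upd k c x) => ABC.
have tangent u : expR B * (1 + (u - B)) <= expR u.
  rewrite -[leRHS](_ : expR B * expR (u - B) = _); last by rewrite -expRD addrC subrK.
  by rewrite ler_wpM2l ?expR_ge0// expR_ge1Dx.
have hA := tangent A; have hC := tangent C.
have cb : 0 <= c - b by rewrite subr_ge0.
have ba : 0 <= b - a by rewrite subr_ge0.
have := ler_wpM2l cb hA; have := ler_wpM2l ba hC.
by have := ler_wpM2l (expR_ge0 B) ABC; nra.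
Qed.

Lemma twice_partially_derivable_ln f : (forall x, 0 < f x) ->
  twice_partially_derivable f -> twice_partially_derivable (fun x => ln (f x)).
Proof.
move=> f0 [df ddf].
have lnD k x : is_derive x (delta_mx ord0 k) (fun x => ln (f x)) ((f x)^-1 * partial k f x).
  apply/is_derive_line.
  have df1 : is_derive (0 : R) (1 : R) (fun t => f (t *: delta_mx ord0 k + x)) (partial k f x).
    by apply/is_derive_line; apply: DeriveDef.
  apply: (is_derive1_comp (f := @ln R)) df1.
  by rewrite scale0r add0r; exact: is_derive1_ln.
split=> [k x|i j x]; first exact: ex_derive.
have -> : partial j (fun x => ln (f x)) = (fun x => (f x)^-1) * partial j f.
  by apply/funext => y; rewrite /partial; exact: derive_val.
apply: derivableM => //; apply: derivableV => //.
by rewrite gt_eqF.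
Qed.

End calculus.

(** * The correlation inequalities *)

Lemma covariance_L2 {disp} {T : measurableType disp} {R : realType}
    (P : probability T R) (a b : T -> R) : L2 P a -> L2 P b ->
  covariance P a b =
  (\int[P]_x (a x * b x) - \int[P]_x a x * \int[P]_x b x)%:E.
Proof.
move=> a2 b2.
have la := L2_L1 a2; have lb := L2_L1 b2; have lab := L2_mul a2 b2.
rewrite covarianceE; try by apply/Lfun1_integrable.
by rewrite EFinB EFinM !L1_fineK// unlock.
Qed.

Section assembly.
Context {R : realType} {d : nat}.
Local Notation V := 'rV[R]_d.
Variable mu : probability V R.

Lemma L2_of_Lfun (f : V -> R) : f \in Lfun mu 2%:E -> L2 mu f.
Proof.
move=> f2; split; last exact: Lfun2_integrable_sqr f2.
by have /sub_Lfun_mfun := f2; rewrite inE.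
Qed.

(** A function phi with f = exp (- phi) is determined by f, so that its second
derivatives exist as soon as those of f do. *)
Lemma partial2_ln (f phi : V -> R) : twice_partially_derivable f ->
  (forall x, f x = expR (- phi x)) ->
  forall i j x, partial2 i j (fun x => ln (f x)) x = - partial2 i j phi x.
Proof.
move=> df fE i j x.
have f0 y : 0 < f y by rewrite fE expR_gt0.
have [dL ddL] := twice_partially_derivable_ln f0 df.
have -> : phi = - (fun x => ln (f x)).
  by apply/funext => y; rewrite /GRing.opp/= fE expRK opprK.
rewrite /partial2 (_ : partial j (- _) = - partial j (fun x => ln (f x))).
  by apply/eqP; rewrite eq_sym eqr_oppLR; apply/eqP; exact: deriveN.
by apply/funext => y; rewrite /partial deriveN.
Qed.

End assembly.
Theorem corollary1p11 (R : realType) (d : nat)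
    (mus : 'I_d -> probability R R) (mu : probability 'rV[R]_d R)
    (f g : 'rV[R]_d -> R)
    (mu_prod : is_product_probability mus mu)
    (mus_moment2 : forall i : 'I_d,
       (\int[mus i]_t (t ^+ 2)%:E < +oo)%E)
    (f_L2 : f \in Lfun mu 2%:E) (g_L2 : g \in Lfun mu 2%:E)
    (f_derivable : twice_partially_derivable f)
    (g_derivable : twice_partially_derivable g)
    (f_integrable : integrable_partials mu f)
    (g_integrable : integrable_partials mu g) :
  (forall phi : 'rV[R]_d -> R,
     (forall x, f x = expR (- phi x)) ->
     (forall (i j : 'I_d) (x : 'rV[R]_d),
        partial2 i j phi x <= 0 /\ 0 <= partial2 i j g x) ->
     (forall i : 'I_d, covariance mu f (fun x => x ord0 i) = 0%E) ->
     (0 <= covariance mu f g)%E)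
  /\
  (forall phi psi : 'rV[R]_d -> R,
     (forall x, f x = expR (- phi x)) ->
     (forall x, g x = expR (- psi x)) ->
     (forall (i j : 'I_d) (x : 'rV[R]_d),
        partial2 i j phi x <= 0 /\ partial2 i j psi x <= 0) ->
     symmetric_measure mu ->
     even_fun f -> even_fun g ->
     (0 <= covariance mu f g)%E).
Proof.
have mu_swap : swap_invariant mu by exact: preserving_swap mu_prod.
have coord2 k : L2 mu (fun x => x ord0 k).
  apply: (preserving_L2 (preserving_coord mu_prod k) (h := id)); split => //.
  apply/integrableP; split.
    by apply/measurable_EFinP; exact: measurable_funX.
  under eq_integral do rewrite /= ger0_norm ?sqr_ge0//.
  exact: mus_moment2.
have f2 := L2_of_Lfun f_L2; have g2 := L2_of_Lfun g_L2.
have ln_pos (h phi : 'rV[R]_d -> R) : twice_partially_derivable h ->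
    (forall x, h x = expR (- phi x)) ->
    (forall i j x, partial2 i j phi x <= 0) ->
    [/\ forall x, 0 < h x, log_supermodular rv_join rv_meet h &
        forall k, convex_along k h].
  move=> dh hE phi0; have h0 x : 0 < h x by rewrite hE expR_gt0.
  have dL := twice_partially_derivable_ln h0 dh.
  have hL : h = (fun x => expR (ln (h x))) by apply/funext => x; rewrite lnK ?posrE.
  have L0 i j x : 0 <= partial2 i j (fun x => ln (h x)) x.
    by rewrite (partial2_ln dh hE) oppr_ge0.
  split=> //; rewrite hL.
    by apply: log_supermodular_expR => k; exact: supermodular_along_of_partial2.
  by move=> k; apply: convex_along_expR; exact: convex_along_of_partial2.
rewrite covariance_L2// lee_fin subr_ge0; split.
- move=> phi fE H cov0.
  have [f0 lsmf cvxf] := ln_pos f phi f_derivable fE (fun i j x => (H i j x).1).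
  have g0 i j x : 0 <= partial2 i j g x by case: (H i j x).
  apply: (correlation_of_cross_ge0 mu_swap coord2 f2 g2) => //.
    by move=> k; exact: convex_along_of_partial2.
  move=> k; have fX0 : \int[mu]_x (f x * centered_coord mu k x) = 0.
    have := cov0 k; rewrite covariance_L2// => -[] fk.
    transitivity (\int[mu]_x (f x * x ord0 k + - (\int[mu]_y y ord0 k) * f x)).
      by apply: eq_Rintegral => x _; rewrite /centered_coord; ring.
    rewrite RintD; [|exact: L2_mul|by apply: L1Z; exact: L2_L1].
    by rewrite RintZ; [lra|case: f2].
  apply: (cross_ge0_orthogonal mu_swap coord2 f2 f0 lsmf fX0 (S := fun i => (i < k)%N)).
  + by rewrite ltnn.
  + by move=> i; rewrite leq_eqVlt.
  + exact: g2.
  + exact: supermodular_along_of_partial2.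
- move=> phi psi fE gE H mu_sym f_even g_even.
  have [f0 lsmf cvxf] := ln_pos f phi f_derivable fE (fun i j x => (H i j x).1).
  have [g0 lsmg cvxg] := ln_pos g psi g_derivable gE (fun i j x => (H i j x).2).
  apply: (correlation_of_cross_ge0 mu_swap coord2 f2 g2) => //.
  move=> k; apply: (cross_ge0_even mu_swap coord2 f2 f0 lsmf g2 g0 lsmg) => //.
  split=> //; apply: measurable_rV => i; under eq_fun do rewrite mxE.
  exact: measurableT_comp (measurable_coord i).
Qed.
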